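(* The centralizer in $\operatorname{GL}(8,2)=\operatorname{GL}(V_8)$ of the subgroup $\mathcal{G}_{\mathcal{S}}^{0}$ is the subgroup $\mathcal{Z}:=\langle W\rangle\cong Z_{3}$, where $W\in\operatorname{GL}(V_8)$ is the linear map given on the basis $e_1,\ldots,e_8$ by $$e_1\mapsto e_2+e_4+e_6,\quad e_2\mapsto e_2+e_1+e_3+e_5,\quad e_3\mapsto e_2+e_4+e_8,\quad e_4\mapsto e_4+e_1+e_3+e_7,$$ $$e_5\mapsto e_2+e_6+e_8,\quad e_6\mapsto e_6+e_1+e_5+e_7,\quad e_7\mapsto e_4+e_6+e_8,\quad e_8\mapsto e_8+e_3+e_5+e_7,$$ and $W$ fixes (setwise) each line of the $\mathcal{G}_{\mathcal{S}}$-invariant set $\{L(p): p\in\mathcal{S}\}$ of distinguished tangents. Moreover the orbits of $\mathcal{Z}$ on the points of $\operatorname{PG}(7,2)$ constitute a $\mathcal{G}_{\mathcal{S}}$-invariant spread $\mathcal{L}_{85}$ of $85$ lines.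
   Context: Everything is over $\operatorname{GF}(2)$. Let $V_2$ be a 2-dimensional vector space over $\operatorname{GF}(2)$ with nonzero vectors $u_0,u_1,u_2$ (so $u_2=u_0+u_1$), and $V_8=V_2\otimes V_2\otimes V_2$. Points of $\operatorname{PG}(7,2)=\mathbb{P}V_8$ are identified with nonzero vectors of $V_8$; a line is a set $\{x,y,x+y\}$ with $x\ne y$ nonzero. A spread of lines is a set of lines partitioning the points. Put $E_{ijk}=u_i\otimes u_j\otimes u_k$ for $i,j,k\in\{0,1,2\}$. The Segre variety is the 27-point set $\mathcal{S}=\mathcal{S}_{1,1,1}(2)=\{E_{ijk}\}$. Its stabilizer in $\operatorname{GL}(V_8)$ is $\mathcal{G}_{\mathcal{S}}=\mathcal{N}\rtimes\operatorname{Sym}(3)$ (order 1296), where $\mathcal{N}=\operatorname{GL}(V_2)\times\operatorname{GL}(V_2)\times\operatorname{GL}(V_2)$ acts by the maps $a_1\otimes a_2\otimes a_3$ and $\operatorname{Sym}(3)$ acts by permuting the three tensor factors. Let $\mathcal{H}\cong Z_3$ be the index 2 subgroup of $\operatorname{GL}(V_2)$; let $\mathcal{N}_0$ be the index 2 subgroup of $\mathcal{N}$ consisting of those $a_1\otimes a_2\otimes a_3$ for which an even number (0 or 2) of the $a_i$ lie in $\operatorname{GL}(V_2)\setminus\mathcal{H}$; and $\mathcal{G}_{\mathcal{S}}^{0}=\mathcal{N}_0\rtimes\operatorname{Sym}(3)$, an index 2 subgroup of $\mathcal{G}_{\mathcal{S}}$. The basis is $e_1=E_{000},\ e_2=E_{100},\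 e_3=E_{110},\ e_4=E_{010},\ e_5=E_{101},\ e_6=E_{001},\ e_7=E_{011},\ e_8=E_{111}$. Generators of $\mathcal{S}$ are the 27 lines obtained from $\mathcal{S}$ by fixing two of the three indices of $E_{ijk}$ and letting the third vary; exactly three pass through each $p\in\mathcal{S}$, and they span a 3-flat (projective 3-dimensional subspace) $Z(p)$. The distinguished tangent at $p\in\mathcal{S}$ is the line $L(p)=\{p,p',p''\}$, where $p',p''$ are the two points of $Z(p)$ lying in none of the three planes spanned by two of the generators through $p$. *)

(* Defs.v *)
From HB Require Import structures.
From mathcomp Require Import all_boot all_order all_algebra all_fingroup.
From mathcomp Require Import all_solvable.
From mathcomp Require Import mxtens.
Set Implicit Arguments.
Unset Strict Implicit.
Unset Printing Implicit Defensive.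
Import GRing.Theory.
Local Open Scope ring_scope.

(* V_2 is modelled by row vectors of length 2, and V_8 by their Kronecker
   products. Linear maps act on row vectors on the right, so that a product
   g * h in {'GL_n['F_2]} is "g, then h". *)
Notation V2 := 'rV['F_2]_2.
Notation V8 := 'rV['F_2]_8.
Notation GL2 := {'GL_2['F_2]}.
Notation GL8 := {'GL_8['F_2]}.

(* The ascriptions below convert 2 * 2 * 2 to 8 and 1 * 1 * 1 to 1. *)
Definition tens3v (x : 'I_3 -> V2) : V8 := x 0 *t x 1 *t x 2%:R.
Definition tens3m (a : 'I_3 -> 'M['F_2]_2) : 'M['F_2]_8 :=
  a 0 *t a 1 *t a 2%:R.

Lemma V8act_is1 : (fun (x : V8) (g : GL8) => x *m GLval g)^~ 1%g =1 id.
Proof. by move=> x; rewrite /= mulmx1. Qed.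

Lemma V8act_isM (x : V8) :
  act_morph (fun (x : V8) (g : GL8) => x *m GLval g) x.
Proof. by move=> g h; rewrite /= mulmxA. Qed.

Definition V8act : {action GL8 &-> V8} := TotalAction V8act_is1 V8act_isM.

Definition points : {set V8} := [set x | x != 0].

Definition is_line (l : {set V8}) : Prop :=
  exists x y : V8, [/\ x != 0, y != 0, x != y & l = [set x; y; x + y]].

Definition is_line_spread (P : {set {set V8}}) : Prop :=
  {in P, forall l, is_line l} /\ partition P points.

(* The points of the projective subspace spanned by A. *)
Definition flat (A : {set V8}) : {set V8} :=
  [set x in points | x \in <<enum A>>%VS].

Section Segre.

Variable u : 'I_3 -> V2.

Definition E (i j k : 'I_3) : V8 := u i *t u j *t u k.

Definition segre : {set V8} :=
  [set E t.1.1 t.1.2 t.2 | t : 'I_3 * 'I_3 * 'I_3].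

(* The setwise stabilizer of the Segre variety in GL(V_8). *)
Definition segre_stab : {set GL8} := 'N(segre | V8act)%g.

Definition generators : {set {set V8}} :=
  [set [set E i t.1 t.2 | i : 'I_3] | t : 'I_3 * 'I_3]
  :|: [set [set E t.1 j t.2 | j : 'I_3] | t : 'I_3 * 'I_3]
  :|: [set [set E t.1 t.2 k | k : 'I_3] | t : 'I_3 * 'I_3].

Definition generators_at (p : V8) : {set {set V8}} :=
  [set l in generators | p \in l].

Definition Zflat (p : V8) : {set V8} := flat (cover (generators_at p)).

Definition dist_tangent (p : V8) : {set V8} :=
  p |: [set x in Zflat p | [forall l in generators_at p,
         forall l' in generators_at p, (l != l') ==> (x \notin flat (l :|: l'))]].

Definition dist_tangents : {set {set V8}} :=
  [set dist_tangent p | p in segre].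

Definition W_spec (W : GL8) : Prop :=
  let e1 := E 0 0 0 in let e2 := E 1 0 0 in
  let e3 := E 1 1 0 in let e4 := E 0 1 0 in
  let e5 := E 1 0 1 in let e6 := E 0 0 1 in
  let e7 := E 0 1 1 in let e8 := E 1 1 1 in
  [/\ V8act e1 W = e2 + e4 + e6,
      V8act e2 W = e2 + e1 + e3 + e5,
      V8act e3 W = e2 + e4 + e8 &
      V8act e4 W = e4 + e1 + e3 + e7] /\
  [/\ V8act e5 W = e2 + e6 + e8,
      V8act e6 W = e6 + e1 + e5 + e7,
      V8act e7 W = e4 + e6 + e8 &
      V8act e8 W = e8 + e3 + e5 + e7].

End Segre.

(* The pure tensors a_1 (x) a_2 (x) a_3 with evenly many a_i outside H. *)
Definition N0 (H : {set GL2}) : {set GL8} :=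
  [set g : GL8 | [exists a : {ffun 'I_3 -> GL2},
     (GLval g == tens3m (fun i => GLval (a i)))
     && ~~ odd #|[set i | a i \notin H]|]].

(* The linear maps permuting the three tensor factors; each is determined by
   its values on the decomposable tensors. *)
Definition Sym3 : {set GL8} :=
  [set g : GL8 | [exists s : 'S_3, forall x : {ffun 'I_3 -> V2},
     V8act (tens3v x) g == tens3v (x \o s)]].

(* The internal semidirect product A ><| B is A * B when A and B are groups,
   B normalises A and A meets B trivially, and is set0 otherwise. *)
Definition segre_group0 (H : {set GL2}) : {set GL8} := (N0 H ><| Sym3)%g.

(* Main.v *)
Require Import Defs.
From mathcomp Require Import all_boot all_order all_algebra all_fingroup.
From mathcomp Require Import all_solvable.
From mathcomp Require Import mxtens ssrAC.
Set Implicit Arguments.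
Unset Strict Implicit.
Unset Printing Implicit Defensive.
Import GRing.Theory.
Local Open Scope ring_scope.

(** Let h be the linear map u_i |-> u_(i+1) of V_2, indices modulo 3, and let
    h_m be h acting on the m-th tensor factor. As u_i + u_(i+1) = u_(i+2),
    h^2 = h + 1, and the map of the theorem is W = h_0 + h_1 + h_2. The h_m
    commute, so in characteristic 2 W^2 is the sum of the h_m^2 = h_m + 1, that
    is W^2 = W + 1 ([Wmx_sqr]). Hence W has order 3, moves every point x, and
    the orbit of x is the line {x, xW, x + xW}: the orbits form a spread, with
    255 / 3 = 85 members.

    Centralizer. The subgroup H is generated by h, and a in GL(V_2) satisfies
    h a = a h + [a is not in H] a ([rot_mul]). Moving W across a_1 (x) a_2 (x)
    a_3 thus adds the parity of the number of a_i outside H, and W commutes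
    with N_0 ([Wmx_tens3m]); that it commutes with Sym(3) is visible from its
    symmetry. Conversely let c centralize N_0 and let p = E_000. The products of
    powers of the h_m lie in N_0 and are transitive on S, which spans V_8, so c
    is determined by pc. This vector is fixed by the stabilizer of p in N_0,
    which contains, for each pair of factors, the map exchanging u_1 and u_2
    on both; in coordinates these three maps leave only the span of p
    and pW ([fixed_table], [N0_fixed]). So c = a + bW with (a, b) <> 0, that is
    c = 1, W or W^2.

    Tangents. If q_0, q_1, q_2 are the points p moved one step along each of the
    three generators through p, then p and the q_m span Z(p), the point p' must
    have coefficient 1 at each q_m, and q_0 + q_1 + q_2 = pW: so
    L(p) = {p, pW, p + pW} ([dist_tangent_Ept]). The generators are exactly the
    lines contained in S ([segre_line], [generator_lineP]), so the stabilizer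
    of S permutes them, and with them the tangents ([dist_tangent_act]).

    Spread. If g stabilizes S and p is in S, then pW^g lies on L(p) and is
    not p, so pW^g = pW + A(p)p with A(p) in GF(2).
    Linearity along a generator forces A to be constant on it, and generators
    connect S; so W^g = W + A with A constant, that is W^g = W or W^2, and g
    normalizes <W> ([segre_stab_norm_W]).

    Vectors are told apart by the 27 linear forms [tcoord k], the product forms
    built from the symplectic form of V_2: as that form takes the value 1 on
    every pair of distinct nonzero vectors, [tcoord k] at E_s is 1 when s and k
    differ in all three places and 0 otherwise. *)

(** * Characteristic 2 and three indices *)

Lemma F2P (a : 'F_2) : a = 0 \/ a = 1.
Proof. by case: a => [[|[|//]] ?]; [left | right]; apply: val_inj. Qed.

Lemma mx2_addrr m n (A : 'M['F_2]_(m, n)) : A + A = 0.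
Proof.
apply/matrixP => i j; rewrite !mxE.
by case: (F2P (A i j)) => ->; apply: val_inj.
Qed.

Lemma mx2_addK m n (A B : 'M['F_2]_(m, n)) : A + B + B = A.
Proof. by rewrite -addrA mx2_addrr addr0. Qed.

Lemma mx2_addKl m n (A B : 'M['F_2]_(m, n)) : A + (A + B) = B.
Proof. by rewrite addrA mx2_addrr add0r. Qed.

Lemma mx2_add_eq0 m n (A B : 'M['F_2]_(m, n)) : (A + B == 0) = (A == B).
Proof.
apply/eqP/eqP => [AB0 | ->]; last exact: mx2_addrr.
by rewrite -[A](mx2_addK _ B) AB0 add0r.
Qed.

Lemma I3P (i : 'I_3) : [\/ i = 0, i = 1 | i = 2%:R].
Proof.
by case: i => [[|[|[|//]]] ?];
  [apply: Or31 | apply: Or32 | apply: Or33]; apply: val_inj.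
Qed.

(** * Threefold Kronecker products *)

(** The common form of [tens3v], [tens3m] and of products of three linear
    forms, to all of which its instances are convertible. *)
Definition tens3 m n (A : 'I_3 -> 'M['F_2]_(m, n)) :
  'M_(m * m * m, n * n * n) := A 0 *t A 1 *t A 2%:R.

Lemma eq_tens3 m n (A B : 'I_3 -> 'M['F_2]_(m, n)) :
  A =1 B -> tens3 A = tens3 B.
Proof. by move=> AB; rewrite /tens3 !AB. Qed.

Lemma tens3_mul m n p (A : 'I_3 -> 'M['F_2]_(m, n))
    (B : 'I_3 -> 'M['F_2]_(n, p)) :
  tens3 A *m tens3 B = tens3 (fun i => A i *m B i).
Proof. by rewrite /tens3 !tensmx_mul. Qed.

Lemma tens3D m n (A B C : 'I_3 -> 'M['F_2]_(m, n)) k :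
    A k = B k + C k -> (forall i, i != k -> A i = B i /\ A i = C i) ->
  tens3 A = tens3 B + tens3 C.
Proof.
move=> Ak Ai; rewrite /tens3.
by case: (I3P k) => Dk; rewrite {k}Dk in Ak Ai; rewrite Ak;
   do ![match goal with |- context [A ?i] =>
     have [] // := Ai i; move: (A i) => ? <- <- end];
   apply/matrixP => i j; rewrite !mxE /= ?mulrDr ?mulrDl.
Qed.

Lemma tens3_11 (A : 'I_3 -> 'M['F_2]_1) :
  (tens3 A : 'M_1) 0 0 = \prod_i A i 0 0.
Proof.
rewrite /tens3 3!big_ord_recl big_ord0 mulr1 !mxE /= -mulrA.
by congr (_ * (_ * _)); congr (A _ _ _); apply: val_inj.
Qed.

Lemma delta_mx_tens m n (i : 'I_m) (j : 'I_n) :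
  delta_mx 0 (mxtens_index (i, j))
    = (delta_mx 0 i : 'rV_m) *t (delta_mx 0 j : 'rV_n)
    :> 'rV['F_2]_(m * n).
Proof.
apply/rowP => l; case: (mxtens_indexP l) => i' j'.
have ->: 0 = mxtens_index (0 : 'I_1, 0 : 'I_1) :> 'I_1 by rewrite ord1.
apply: etrans (esym (tensmxE (delta_mx 0 i) (delta_mx 0 j) 0 0 i' j')).
rewrite !mxE /= -natrM mulnb (can_eq (@mxtens_indexK m n)).
by rewrite xpair_eqE ?ord1 ?eqxx.
Qed.

Lemma tens3v_ext n (A B : 'M['F_2]_(8, n)) :
  (forall x, tens3v x *m A = tens3v x *m B) -> A = B.
Proof.
move=> AB; apply/row_matrixP => k; rewrite !rowE.
suffices [x ->] : exists x, delta_mx 0 k = tens3v x by apply: AB.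
case: (@mxtens_indexP (2 * 2) 2 k) => ij l; case: (mxtens_indexP ij) => i j.
exists (tnth [tuple delta_mx 0 i; delta_mx 0 j; delta_mx 0 l]).
apply: etrans (@delta_mx_tens (2 * 2) 2 (mxtens_index (i, j)) l) _.
by rewrite delta_mx_tens /tens3v !(tnth_nth 0).
Qed.

(** Dual to [tens3v_ext]: the product forms separate vectors because their
    transposes are the decomposable tensors. *)
Lemma tens3_sep (v : V8) :
  (forall f : 'I_3 -> 'cV_2, v *m (tens3 f : 'cV_8) = 0) -> v = 0.
Proof.
move=> v0; apply: trmx_inj; apply: tens3v_ext => x.
rewrite trmx0 mulmx0; apply: trmx_inj; rewrite trmx_mul trmxK trmx0.
rewrite -[RHS](v0 (fun i => (x i)^T)); congr (_ *m _).
apply: etrans (trmx_tens (x 0 *t x 1) (x 2%:R)) _.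
by rewrite trmx_tens.
Qed.

(** * The plane and its three nonzero vectors *)

(** The linear form x |-> det (x, w), the invariant symplectic form of the
    plane; over GF(2) the sign is immaterial and [i + 1] is the other index. *)
Definition symp (w : V2) : 'cV['F_2]_2 := \col_i w 0 (i + 1).

Lemma sympE (x w : V2) : (x *m symp w) 0 0 = x 0 0 * w 0 1 + x 0 1 * w 0 0.
Proof.
rewrite !mxE 2!big_ord_recl big_ord0 addr0 !mxE.
by congr (x _ _ * w _ _ + x _ _ * w _ _); apply: val_inj.
Qed.

Lemma symp_neq (x w : V2) : x != 0 -> w != 0 -> (x *m symp w) 0 0 = (x != w)%:R.
Proof.
have V2E (y z : V2) : (y == z) = (y 0 0 == z 0 0) && (y 0 1 == z 0 1).
  apply/eqP/andP => [-> | [/eqP y0 /eqP y1]]; first by [].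
  by apply/rowP => i; case: (F2P (i : 'F_2)) => ->.
rewrite sympE !V2E !mxE.
by case: (F2P (x 0 0)) => ->; case: (F2P (x 0 1)) => ->;
  case: (F2P (w 0 0)) => ->; case: (F2P (w 0 1)) => -> //= _ _; apply: val_inj.
Qed.

Section Plane.

Variable u : 'I_3 -> V2.
Hypotheses (u_inj : injective u) (u_neq0 : forall i, u i != 0).

Lemma u_surj (x : V2) : x != 0 -> exists i, x = u i.
Proof.
move=> x0; suffices /setP/(_ x): u @: setT = [set~ 0].
  by rewrite in_setC1 x0 => /imsetP[i _ ->]; exists i.
apply/eqP; rewrite eqEcard; apply/andP; split.
  by apply/subsetP => _ /imsetP[i _ ->]; rewrite in_setC1.
by rewrite cardsC1 card_imset // cardsT card_mx !card_ord.
Qed.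

Lemma u_symp i j : (u i *m symp (u j)) 0 0 = (i != j)%:R.
Proof. by rewrite symp_neq ?(inj_eq u_inj). Qed.

(** The third index completing i and j is - (i + j), as 0 + 1 + 2 = 0
    modulo 3. *)
Lemma uD i j : i != j -> u i + u j = u (- (i + j)).
Proof.
move=> neq_ij; have /u_surj[k Dk]: u i + u j != 0.
  by rewrite mx2_add_eq0 (inj_eq u_inj).
rewrite Dk; congr u.
have: k != i.
  apply: contraNneq (u_neq0 j) => ki.
  by rewrite -(mx2_addKl (u i) (u j)) Dk ki mx2_addrr.
have: k != j.
  apply: contraNneq (u_neq0 i) => kj.
  by rewrite -(mx2_addK (u i) (u j)) Dk kj mx2_addrr.
by move: neq_ij; case: (I3P i) => ->; case: (I3P j) => -> //;
  case: (I3P k) => -> // *; apply: val_inj.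
Qed.

Lemma uS i : u i + u (i + 1) = u (i + 2%:R).
Proof. by rewrite uD; case: (I3P i) => -> //; congr u; apply: val_inj. Qed.

Lemma u_ext n (A B : 'M['F_2]_(2, n)) :
  (forall i, u i *m A = u i *m B) -> A = B.
Proof.
move=> AB; apply/row_matrixP => k; rewrite !rowE.
have /u_surj[i ->] // : delta_mx 0 k != 0 :> V2.
by apply/eqP => /rowP/(_ k)/eqP; rewrite !mxE !eqxx.
Qed.

End Plane.

(** * Points of the Segre variety *)

Definition upd T (s : 'I_3 -> T) m (i : T) : 'I_3 -> T := [eta s with m |-> i].

Lemma upd_at T (s : 'I_3 -> T) m i : upd s m i m = i.
Proof. by rewrite /upd /= eqxx. Qed.

Lemma upd_neq T (s : 'I_3 -> T) m i n : n != m -> upd s m i n = s n.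
Proof. by rewrite /upd /= => /negPf->. Qed.

Lemma upd_id T (s : 'I_3 -> T) m : upd s m (s m) =1 s.
Proof. by move=> n; rewrite /upd /=; case: eqP => // ->. Qed.

Lemma upd_upd T (s : 'I_3 -> T) m i j : upd (upd s m i) m j =1 upd s m j.
Proof. by move=> n; rewrite /upd /=; case: eqP. Qed.

Lemma eq_tens3v x y : x =1 y -> tens3v x = tens3v y.
Proof. exact: (@eq_tens3 1 2 x y). Qed.

Lemma eq_tens3m a b : a =1 b -> tens3m a = tens3m b.
Proof. exact: (@eq_tens3 2 2 a b). Qed.

Lemma tens3v_mul x (a : 'I_3 -> 'M['F_2]_2) :
  tens3v x *m tens3m a = tens3v (fun i => x i *m a i).
Proof. exact: (tens3_mul x a). Qed.

Lemma tens3m_mul (a b : 'I_3 -> 'M['F_2]_2) :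
  tens3m a *m tens3m b = tens3m (fun i => a i *m b i).
Proof. exact: (tens3_mul a b). Qed.

Lemma tens3m1 : tens3m (fun=> 1%:M) = 1%:M.
Proof.
apply: tens3v_ext => x; rewrite tens3v_mul mulmx1.
by apply: eq_tens3v => i; rewrite mulmx1.
Qed.

Lemma tens3v0 x m : x m = 0 -> tens3v x = 0.
Proof.
move=> xm0; rewrite -[RHS](mx2_addrr (tens3v x)).
by apply: (@tens3D 1 2 x x x m) => //; rewrite xm0 addr0.
Qed.

(** A third index: a product form built on it is 1 at a factor whichever of
    the two points, with indices i and j there, is considered. *)
Definition avoid (i j : 'I_3) : 'I_3 := if i == j then i + 1 else - (i + j).

Lemma avoid_l i j : i != avoid i j.
Proof. by case: (I3P i) => ->; case: (I3P j) => ->. Qed.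

Lemma avoid_r i j : j != avoid i j.
Proof. by case: (I3P i) => ->; case: (I3P j) => ->. Qed.

Section Points.

Variable u : 'I_3 -> V2.
Hypotheses (u_inj : injective u) (u_neq0 : forall i, u i != 0).

(** The point E_(s 0)(s 1)(s 2). Indexing by functions on the set of factors
    lets one argument serve all three factors. *)
Definition Ept (s : 'I_3 -> 'I_3) : V8 := tens3v (u \o s).

Lemma eq_Ept s t : s =1 t -> Ept s = Ept t.
Proof. by move=> st; apply: eq_tens3v => i; rewrite /= st. Qed.

Lemma segreP x : reflect (exists s, x = Ept s) (x \in segre u).
Proof.
apply: (iffP imsetP) => [[[[i j] k] _ ->]|[s ->]]; last first.
  by exists (s 0, s 1, s 2%:R).
by exists (tnth [tuple i; j; k]); rewrite /Ept /tens3v /= !(tnth_nth 0).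
Qed.

Lemma Ept_segre s : Ept s \in segre u. Proof. by apply/segreP; exists s. Qed.

Lemma Ept_ext n (A B : 'M_(8, n)) :
  (forall s, Ept s *m A = Ept s *m B) -> A = B.
Proof.
move=> AB; apply: tens3v_ext => x.
have [/existsP[m /eqP xm0] | ] := boolP [exists m, x m == 0].
  by rewrite (tens3v0 xm0) !mul0mx.
rewrite negb_exists => /forallP x_neq0.
suffices [s /eq_tens3 Dx] : exists s, x =1 u \o s.
  by rewrite (_ : tens3v x = Ept s) ?AB //; exact: Dx.
have P i : exists j, x i == u j.
  by have [j ->] := u_surj u_inj u_neq0 (x_neq0 i); exists j.
by exists (fun i => xchoose (P i)) => i; apply/eqP/(xchooseP (P i)).
Qed.

(** On the basis vectors with indices 0 and 1 the eight forms with indices 0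
    and 1 are, up to exchanging 0 and 1, the dual basis; the other forms are
    sums of these, and keeping all 27 makes the three values of an index
    interchangeable. *)
Definition tcoord (k : 'I_3 -> 'I_3) (v : V8) : 'F_2 :=
  (v *m (tens3 (fun i => symp (u (k i))) : 'cV_8)) 0 0.

Lemma tcoordD k v w : tcoord k (v + w) = tcoord k v + tcoord k w.
Proof. by rewrite /tcoord mulmxDl mxE. Qed.

Lemma tcoord_Ept k s : tcoord k (Ept s) = [forall m, s m != k m]%:R.
Proof.
have ->: tcoord k (Ept s) = \prod_m (u (s m) *m symp (u (k m))) 0 0.
  rewrite -tens3_11; congr (_ _ 0 0).
  exact: (tens3_mul (u \o s) (fun i => symp (u (k i)))).
rewrite (eq_bigr (fun m => (s m != k m)%:R)) => [|m _]; last exact: u_symp.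
case: forallP => [sk | /forallP]; first by rewrite big1 // => m _; rewrite sk.
rewrite negb_forall => /existsP[m /negPn skm].
by rewrite (bigD1 m) //= skm mul0r.
Qed.

Lemma tcoord_sep v : (forall k, tcoord k v = 0) -> v = 0.
Proof.
move=> v0; apply: tens3_sep => f.
have [/existsP[m /eqP fm0] | ] := boolP [exists m, f m == 0].
  suffices ->: tens3 f = 0 by rewrite mulmx0.
  rewrite -[RHS](mx2_addrr (tens3 f)).
  by apply: (@tens3D _ _ f f f m) => //; rewrite fm0 addr0.
rewrite negb_exists => /forallP f_neq0.
pose x i : V2 := \row_j f i (j + 1) 0.
have x_symp i : symp (x i) = f i.
  apply/colP => j; rewrite !mxE -addrA.
  by congr (f i _ 0); case: (F2P (j : 'F_2)) => ->; apply: val_inj.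
have P i : exists j, x i == u j.
  have [|j ->] := u_surj u_inj u_neq0 (_ : x i != 0); last by exists j.
  apply: contraNneq (f_neq0 i) => xi0; rewrite -x_symp xi0; apply/eqP.
  by apply/colP => j; rewrite !mxE.
apply/matrixP => i j; rewrite !ord1 [RHS]mxE -(v0 (fun i => xchoose (P i))).
congr ((v *m _) 0 0); apply: (@eq_tens3 2 1) => l.
by rewrite -x_symp; congr symp; apply/eqP/(xchooseP (P l)).
Qed.

Lemma Ept_inj s t : Ept s = Ept t -> s =1 t.
Proof.
move=> st m; apply: contra_eq st => neq.
pose k (i : 'I_3) := if i == m then s m else avoid (s i) (t i).
apply/eqP => /(congr1 (tcoord k)).
rewrite !tcoord_Ept /k; case: forallP => [/(_ m)|_]; first by rewrite !eqxx.
case: forallP => // [[]] i; case: (i =P m) => [->|_]; last exact: avoid_r.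
by rewrite eq_sym.
Qed.

Lemma Ept_neq0 s : Ept s != 0.
Proof.
apply/eqP => /(congr1 (tcoord (fun i => avoid (s i) (s i)))).
rewrite tcoord_Ept /tcoord mul0mx mxE; case: forallP => // [[]] i.
exact: avoid_l.
Qed.

Lemma Ept_upd_add s m i j : i != j ->
  Ept (upd s m i) + Ept (upd s m j) = Ept (upd s m (- (i + j))).
Proof.
move=> neq_ij; apply/esym/(@tens3D 1 2 _ _ _ m) => [|n nm] /=.
  by rewrite !upd_at uD.
by rewrite !upd_neq.
Qed.

Lemma Ept_addS s m :
  Ept s + Ept (upd s m (s m + 1)) = Ept (upd s m (s m + 2%:R)).
Proof.
rewrite -(eq_Ept (upd_id s m)) Ept_upd_add.
  by congr (Ept (upd _ _ _)); case: (I3P (s m)) => ->; apply: val_inj.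
by case: (I3P (s m)) => ->.
Qed.

(** Contract the remaining factor with a form that is 1 on both points: on
    the left this gives a sum of two tensors with independent factors, of
    rank 2, and on the right a tensor of rank at most 1. Three product forms
    suffice to see the difference. *)
Lemma segre_line s t r m n : m != n -> s m != t m -> s n != t n ->
  Ept s + Ept t != Ept r.
Proof.
move=> mn sm sn; pose c a b i :=
  if i == m then a else if i == n then b else avoid (s i) (t i).
apply/eqP => D.
have Dc a b : [forall i, s i != c a b i]%:R + [forall i, t i != c a b i]%:R
    = [forall i, r i != c a b i]%:R :> 'F_2.
  by rewrite -!tcoord_Ept -tcoordD D.
have cm a b : c a b m = a by rewrite /c eqxx.
have cn a b : c a b n = b by rewrite /c eqxx eq_sym (negPf mn).
(* The form with indices from t sees s but not t, so it sees r. *)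
have rt i : r i != c (t m) (t n) i.
  move: i; apply/forallP; move: (Dc (t m) (t n)).
  case: forallP => [_ | []]; last first.
    move=> i; rewrite /c; case: (i =P m) => [-> //|_].
    by case: (i =P n) => [-> //|_]; apply: avoid_l.
  case: forallP => [/(_ m)|_]; first by rewrite cm eqxx.
  by case: forallP.
(* Likewise with s and t exchanged. *)
have rs i : r i != c (s m) (s n) i.
  move: i; apply/forallP; move: (Dc (s m) (s n)).
  case: forallP => [/(_ m)|_]; first by rewrite cm eqxx.
  case: forallP => [_ | []]; last first.
    move=> i; rewrite /c; case: (i =P m) => [->|_]; first by rewrite eq_sym.
    by case: (i =P n) => [->|_]; [rewrite eq_sym | apply: avoid_r].
  by case: forallP.
(* The mixed form sees neither s nor t, but by the above it sees r. *)
move: (Dc (s m) (t n)).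
case: forallP => [/(_ m)|_]; first by rewrite cm eqxx.
case: forallP => [/(_ n)|_]; first by rewrite cn eqxx.
case: forallP => // [[]] i; move: (rt i) (rs i); rewrite /c.
by case: (i =P m) => // _; case: (i =P n).
Qed.

(** * Generators are the lines inside the Segre variety *)

Definition gen_line m s : {set V8} := [set Ept (upd s m i) | i : 'I_3].

Lemma generatorsP l :
  reflect (exists m s, l = gen_line m s) (l \in generators u).
Proof.
have D0 (s : 'I_3 -> 'I_3) : gen_line 0 s
    = [set E u i (s 1) (s 2%:R) | i : 'I_3] by [].
have D1 (s : 'I_3 -> 'I_3) : gen_line 1 s
    = [set E u (s 0) i (s 2%:R) | i : 'I_3] by [].
have D2 (s : 'I_3 -> 'I_3) : gen_line 2%:R s
    = [set E u (s 0) (s 1) i | i : 'I_3] by [].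
rewrite /generators !inE -orbA; apply: (iffP or3P).
  case=> /imsetP[[i j] _ ->].
  - by exists 0, (tnth [tuple i; i; j]); rewrite D0 !(tnth_nth 0).
  - by exists 1, (tnth [tuple i; i; j]); rewrite D1 !(tnth_nth 0).
  - by exists 2%:R, (tnth [tuple i; j; j]); rewrite D2 !(tnth_nth 0).
case=> m [s ->]; case: (I3P m) => ->.
- by apply: Or31; rewrite D0; apply/imsetP; exists (s 1, s 2%:R).
- by apply: Or32; rewrite D1; apply/imsetP; exists (s 0, s 2%:R).
- by apply: Or33; rewrite D2; apply/imsetP; exists (s 0, s 1).
Qed.

Lemma gen_line_split m s i j : i != j -> gen_line m s
  = [set Ept (upd s m i); Ept (upd s m j); Ept (upd s m i) + Ept (upd s m j)].
Proof.
move=> ij; rewrite Ept_upd_add //; apply/setP => x; rewrite !inE -orbA.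
apply/imsetP/or3P => [[k _ ->] | [] /eqP->]; last 3 first.
- by exists i.
- by exists j.
- by exists (- (i + j)).
have [->|ki] := eqVneq k i; first by apply: Or31.
have [->|kj] := eqVneq k j; first by apply: Or32.
apply: Or33; rewrite (_ : k = - (i + j)) //.
by move: ij ki kj; case: (I3P i) => ->; case: (I3P j) => -> //;
  case: (I3P k) => -> // *; apply: val_inj.
Qed.

(** This description mentions only S and addition, so it is carried along by
    any linear map that preserves S. *)
Lemma generator_lineP l : reflect
  (exists x y, [/\ x \in segre u, y \in segre u, x != y, x + y \in segre u
                 & l = [set x; y; x + y]])
  (l \in generators u).
Proof.
apply: (iffP (generatorsP l)) => [[m [s ->]] | ].
  exists (Ept (upd s m 0)), (Ept (upd s m 1)); rewrite -gen_line_split //.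
  split; rewrite ?Ept_upd_add ?Ept_segre //.
  by apply/eqP => /Ept_inj/(_ m); rewrite !upd_at.
case=> _ [_ [/segreP[s ->] /segreP[t ->] st /segreP[r D] ->]].
have [/existsP[m stm] | ] := boolP [exists m, s m != t m]; last first.
  rewrite negb_exists => /forallP eq_st; case/eqP: st; apply: eq_Ept => m.
  by apply/eqP; have:= eq_st m; rewrite negbK.
exists m, s; rewrite (gen_line_split _ _ stm) (eq_Ept (upd_id s m)).
rewrite (@eq_Ept (upd s m (t m)) t) // => n.
have [->|nm] := eqVneq n m; first by rewrite upd_at.
rewrite upd_neq //; apply/eqP; apply: contraTT isT => stn.
by have /eqP := segre_line r nm stn stm.
Qed.

End Points.

(** * The subgroup of index 2 in GL(V_2) *)

Lemma GL_of_mx n (A B : 'M['F_2]_n.+1) : A *m B = 1%:M ->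
  exists g : {'GL_n.+1['F_2]}, GLval g = A.
Proof. by case/mulmx1_unit => uA _; exists (FinRing.Unit uA). Qed.

Lemma GLK m n (x : 'M['F_2]_(m, n.+1)) (g : {'GL_n.+1['F_2]}) :
  x *m GLval g *m GLval g^-1%g = x.
Proof. exact: (mulmxK (valP g)). Qed.

Lemma GLKV m n (x : 'M['F_2]_(m, n.+1)) (g : {'GL_n.+1['F_2]}) :
  x *m GLval g^-1%g *m GLval g = x.
Proof. exact: (mulmxKV (valP g)). Qed.

Lemma index2_memJ (gT : finGroupType) (H : {group gT}) (x a : gT) :
  #|[set: gT] : H|%g = 2%N -> ((x ^ a)%g \in H) = (x \in H).
Proof.
move=> H2; have /normal_norm/subsetP nH : (H <| [set: gT])%g.
  by apply: index2_normal; rewrite ?subsetT.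
by rewrite memJ_norm ?nH ?inE.
Qed.

Lemma index2_notinM (gT : finGroupType) (H : {group gT}) (a b : gT) :
  #|[set: gT] : H|%g = 2%N ->
  ((a * b)%g \notin H) = (a \notin H) (+) (b \notin H).
Proof.
move=> H2.
have [aH | aH] := boolP (a \in H); first by rewrite groupMl.
have [bH | bH] := boolP (b \in H); first by rewrite groupMr ?aH.
have: b \in H :|: (a^-1 *: H)%g.
  suffices /eqP->: H :|: (a^-1 *: H)%g == [set: gT] by rewrite inE.
  have disj : H :&: (a^-1 *: H)%g = set0.
    apply/setP => x; rewrite !inE mem_lcoset invgK; apply/andP => [[xH]].
    by rewrite groupMr // (negPf aH).
  rewrite eqEcard subsetT -(Lagrange (subsetT H)) H2 cardsU card_lcoset disj.
  by rewrite cards0 subn0 addnn muln2 leqnn.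
by rewrite inE (negPf bH) mem_lcoset invgK /= => ->.
Qed.

Section Maps.

Variable u : 'I_3 -> V2.
Hypotheses (u_inj : injective u) (u_neq0 : forall i, u i != 0).

(** A linear map given on u_0 and u_1 is written with the forms [symp (u 1)]
    and [symp (u 0)], the basis dual to u_0, u_1. *)
Lemma rot_exists : exists h : GL2, forall i, u i *m GLval h = u (i + 1).
Proof.
pose A := symp (u 1) *m u 1 + symp (u 0) *m u 2%:R.
have A_rot i : u i *m A = u (i + 1).
  rewrite mulmxDr !mulmxA [u i *m symp (u 1)]mx11_scalar.
  rewrite [u i *m symp (u 0)]mx11_scalar !mul_scalar_mx !u_symp //.
  case: (I3P i) => -> /=; rewrite ?scale0r ?scale1r ?add0r ?addr0.
  - by congr u; apply: val_inj.
  - by congr u; apply: val_inj.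
  - by rewrite uD //; congr u; apply: val_inj.
have [|g gA] := @GL_of_mx _ A (A *m A); last by exists g => i; rewrite gA.
apply: (u_ext u_inj u_neq0) => i; rewrite !mulmxA !A_rot mulmx1.
by congr u; rewrite -!addrA; case: (I3P i) => ->; apply: val_inj.
Qed.

(** The transvection with centre u_0: it fixes u_0 and exchanges u_1 and u_2,
    whose indices are opposite modulo 3. *)
Lemma flip_exists : exists h : GL2, forall i, u i *m GLval h = u (- i).
Proof.
pose A := 1%:M + symp (u 0) *m u 0.
have A_flip i : u i *m A = u (- i).
  rewrite mulmxDr mulmx1 !mulmxA [u i *m symp (u 0)]mx11_scalar.
  rewrite !mul_scalar_mx !u_symp //.
  have [->|i0] := eqVneq i 0; first by rewrite scale0r addr0 oppr0.
  by rewrite scale1r uD // addr0.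
have [|g gA] := @GL_of_mx _ A A; last by exists g => i; rewrite gA.
by apply: (u_ext u_inj u_neq0) => i; rewrite !mulmxA !A_flip mulmx1 opprK.
Qed.

End Maps.

Lemma GL2_ext (u : 'I_3 -> V2) (a b : GL2) :
  injective u -> (forall i, u i != 0) ->
  (forall i, u i *m GLval a = u i *m GLval b) -> a = b.
Proof. by move=> u_inj u_neq0 ab; apply/val_inj/(u_ext u_inj u_neq0). Qed.

Section IndexTwo.

Variable u : 'I_3 -> V2.
Hypotheses (u_inj : injective u) (u_neq0 : forall i, u i != 0).
Variable H : {group GL2}.
Hypothesis H_index2 : #|[set: GL2] : H|%g = 2%N.
Variable rot : GL2.
Hypothesis rotE : forall i, u i *m GLval rot = u (i + 1).

Lemma rot_expE k i : u i *m GLval (rot ^+ k)%g = u (i + k%:R).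
Proof.
elim: k i => [|k IHk] i; first by rewrite expg0 mulmx1 addr0.
rewrite expgS [GLval _]/(GLval rot *m GLval _) mulmxA rotE IHk.
by rewrite -addrA -natr1 [1 + _]addrC.
Qed.

Lemma order_rot : #[rot]%g = 3%N.
Proof.
apply: nt_prime_order => //.
  apply: (GL2_ext u_inj u_neq0) => i; rewrite rot_expE mulmx1.
  by congr u; case: (I3P i) => ->; apply: val_inj.
apply: contra_eqN (rotE 0) => /eqP->; rewrite mulmx1.
by apply/eqP => /u_inj.
Qed.

(** [rot] lies in H as its class has order dividing both 2 and 3; then both
    groups have order 3, as GL(V_2) has order 6. *)
Lemma index2_rot : H = <[rot]>%G.
Proof.
have nHT : (H <| [set: GL2])%g by apply: index2_normal; rewrite ?subsetT.
have nH (a : GL2) : (a \in 'N(H))%g by rewrite (subsetP (normal_norm nHT)) ?inE.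
have cardH : #|H| = 3%N.
  have := Lagrange (subsetT H); rewrite H_index2.
  have ->: #|[set: GL2]| = 6%N by rewrite card_GL_2 card_Fp.
  by rewrite -[6%N]/(3 * 2)%N => /eqP; rewrite eqn_pmul2r // => /eqP.
have rotH : rot \in H.
  apply: coset_idr; first exact: nH.
  have c3 : (coset H rot ^+ 3 = 1)%g.
    have r3 := expg_order rot; rewrite order_rot in r3.
    by rewrite -morphX ?nH // r3 morph1.
  have c2 : (coset H rot ^+ 2 = 1)%g.
    have card2 : #|([set: GL2] / H)%g| = 2%N.
      by rewrite card_quotient ?normal_norm.
    have := @expg_cardG _ ([set: GL2] / H)%G (coset H rot).
    by rewrite card2; apply; rewrite mem_quotient ?inE.
  by move: c3; rewrite expgS c2 mulg1.
apply/esym/eqP; rewrite -val_eqE eqEcard /= cycle_subG rotH cardH.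
by rewrite -[#|_|]/(#[rot]%g) order_rot.
Qed.

(** If u_0 a = u_k then a agrees with the k-th power of [rot] on
    every u_i, since both commute with [rot]. *)
Lemma cent_rot (a : GL2) :
  GLval rot *m GLval a = GLval a *m GLval rot -> a \in H.
Proof.
move=> c_a; have /(u_surj u_inj u_neq0)[k Dk] : u 0 *m GLval a != 0.
  apply: contraNneq (u_neq0 0) => ua0.
  by rewrite -[u 0](@GLK _ 1 _ a) ua0 mul0mx.
rewrite index2_rot; apply/cycleP; exists (val k).
have comX n : GLval (rot ^+ n)%g *m GLval a = GLval a *m GLval (rot ^+ n)%g.
  have: commute a rot by apply/val_inj/esym.
  by move/(commuteX n)/(congr1 val)/esym.
apply: (GL2_ext u_inj u_neq0) => i; rewrite rot_expE.
have ->: u i = u 0 *m GLval (rot ^+ i)%g by rewrite rot_expE add0r natr_Zp.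
rewrite -mulmxA comX mulmxA Dk rot_expE !natr_Zp addrC; congr u.
Qed.

Lemma rot_sqr : GLval (rot ^+ 2)%g = GLval rot + 1%:M.
Proof.
apply: (u_ext u_inj u_neq0) => i.
by rewrite rot_expE mulmxDr rotE mulmx1 [RHS]addrC uS.
Qed.

(** Conjugation by a fixes [rot] or sends it to its square, which is
    [rot] + 1; this additive form of the inversion is what makes parity
    appear in the commutation of W with pure tensors. *)
Lemma rot_mul (a : GL2) :
  GLval rot *m GLval a = GLval a *m GLval rot + (a \notin H)%:R *: GLval a.
Proof.
have Dm (b c : GL2) : GLval (b * c)%g = GLval b *m GLval c by [].
have conj_a : (rot * a = a * rot ^ a)%g by rewrite conjgC.
rewrite -Dm conj_a.
have: (rot ^ a)%g \in H by rewrite index2_memJ // index2_rot cycle_id.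
have [aH | aH] := boolP (a \in H).
  rewrite scale0r addr0 (_ : rot ^ a = rot)%g //.
  apply/conjg_fixP/commgP; move: aH; rewrite index2_rot => /cycleP[n ->].
  exact: commuteX.
rewrite index2_rot => /cyclePmin[[|[|[|n]]]]; rewrite order_rot // => _.
- move/eqP; rewrite expg0 conjg_eq1 => /eqP r1.
  by have := order_rot; rewrite r1 order1.
- rewrite expg1 => ra; case/negP: aH; apply: cent_rot.
  by rewrite -!Dm conj_a ra.
- by move=> ->; rewrite Dm rot_sqr mulmxDr mulmx1 scale1r.
Qed.

Lemma flip_notin (flip : GL2) :
  (forall i, u i *m GLval flip = u (- i)) -> flip \notin H.
Proof.
move=> flipE; apply/negP => flipH; have := rot_mul flip.
rewrite flipH scale0r addr0.
by move/(congr1 (mulmx (u 0))); rewrite !mulmxA rotE !flipE rotE => /u_inj.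
Qed.

End IndexTwo.

(** * The map W *)

Lemma GLM n (g h : {'GL_n['F_2]}) : GLval (g * h)%g = GLval g *m GLval h.
Proof. by []. Qed.

Lemma GL1 n : GLval (1%g : {'GL_n['F_2]}) = 1%:M.
Proof. by []. Qed.

Lemma V8actE (x : V8) (g : GL8) : V8act x g = x *m GLval g.
Proof. by []. Qed.

Lemma V8act1 (x : V8) : V8act x 1%g = x.
Proof. exact: mulmx1. Qed.

Lemma V8actM (x : V8) (g h : GL8) : V8act x (g * h)%g = V8act (V8act x g) h.
Proof. exact: mulmxA. Qed.

Lemma mulg_cycle (gT : finGroupType) (x : gT) : (x * x)%g \in <[x]>%g.
Proof. by rewrite groupM ?cycle_id. Qed.

Lemma V8actD (x y : V8) (g : GL8) : V8act (x + y) g = V8act x g + V8act y g.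
Proof. exact: mulmxDl. Qed.

Lemma tens_GL (a : 'I_3 -> GL2) :
  exists g : GL8, GLval g = tens3m (fun i => GLval (a i)).
Proof.
apply: (@GL_of_mx 7 _ (tens3m (fun i => GLval (a i)^-1%g))).
rewrite tens3m_mul -tens3m1; apply: eq_tens3m => i.
exact: (congr1 val (mulgV (a i))).
Qed.

Lemma big_I3 R (idx : R) (op : Monoid.law idx) (F : 'I_3 -> R) :
  \big[op/idx]_i F i = op (op (F 0) (F 1)) (F 2%:R).
Proof.
rewrite 3!big_ord_recl big_ord0 Monoid.mulm1 Monoid.mulmA.
by congr (op (op (F _) (F _)) (F _)); apply: val_inj.
Qed.

Lemma sumI3 (V : nmodType) (F : 'I_3 -> V) : \sum_i F i = F 0 + F 1 + F 2%:R.
Proof. exact: big_I3. Qed.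

Lemma odd_card3 (P : pred 'I_3) : odd #|[set i | P i]| = P 0 (+) P 1 (+) P 2%:R.
Proof.
rewrite cardsE -sum1_card big_mkcond big_I3 -!topredE /=.
by case: (P 0); case: (P 1); case: (P 2%:R).
Qed.

(** The map a acting on the m-th tensor factor alone. *)
Definition slot m (a : 'M['F_2]_2) : 'M['F_2]_8 :=
  tens3m (upd (fun=> 1%:M) m a).

Lemma tens3v_slot x m a : tens3v x *m slot m a = tens3v (upd x m (x m *m a)).
Proof.
rewrite tens3v_mul; apply: eq_tens3v => n; rewrite /upd /=.
by case: eqP => [->|] //; rewrite mulmx1.
Qed.

Lemma slot_mul m h (a : 'I_3 -> 'M_2) (d : bool) :
  h *m a m = a m *m h + d%:R *: a m ->
  slot m h *m tens3m a = tens3m a *m slot m h + d%:R *: tens3m a.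
Proof.
move=> ha; rewrite !tens3m_mul; case: d ha => ha.
  rewrite scale1r; apply: (@tens3D 2 2 _ _ _ m) => [|n nm].
    by rewrite upd_at ha scale1r.
  by rewrite !upd_neq // mulmx1 mul1mx.
rewrite scale0r addr0; apply: eq_tens3m => n.
have [->|nm] := eqVneq n m; first by rewrite upd_at ha scale0r addr0.
by rewrite upd_neq // mulmx1 mul1mx.
Qed.

Section WFacts.

Variable u : 'I_3 -> V2.
Hypotheses (u_inj : injective u) (u_neq0 : forall i, u i != 0).
Variable rot : GL2.
Hypothesis rotE : forall i, u i *m GLval rot = u (i + 1).

Definition Wmx : 'M['F_2]_8 := \sum_m slot m (GLval rot).

Lemma WmxE : Wmx =
  slot 0 (GLval rot) + slot 1 (GLval rot) + slot 2%:R (GLval rot).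
Proof. by rewrite /Wmx sumI3. Qed.

Lemma Ept_W s : Ept u s *m Wmx = Ept u (upd s 0 (s 0 + 1))
  + Ept u (upd s 1 (s 1 + 1)) + Ept u (upd s 2%:R (s 2%:R + 1)).
Proof.
have slotE m : Ept u s *m slot m (GLval rot) = Ept u (upd s m (s m + 1)).
  rewrite /Ept tens3v_slot /= rotE; apply: eq_tens3v => n.
  by rewrite /upd /=; case: eqP.
by rewrite WmxE !mulmxDr !slotE.
Qed.

(** Evaluating twice at E_s gives nine points; those obtained by moving two
    different indices occur twice and cancel, and moving an index twice gives
    E_s plus the result of moving it once. *)
Lemma Wmx_sqr : Wmx *m Wmx = Wmx + 1%:M.
Proof.
apply: (Ept_ext u_inj u_neq0) => s.
rewrite mulmxA [RHS]mulmxDr mulmx1 !Ept_W !mulmxDl !Ept_W.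
have C m n : m != n ->
      Ept u (upd (upd s m (s m + 1)) n (upd s m (s m + 1) n + 1))
    = Ept u (upd (upd s n (s n + 1)) m (upd s n (s n + 1) m + 1)).
  move=> /negPf mn; have nm : (n == m) = false by rewrite eq_sym.
  apply: eq_Ept => i; rewrite /upd /= mn nm.
  by case: (i =P n) => [->|_] //; rewrite nm.
have D m : Ept u (upd (upd s m (s m + 1)) m (upd s m (s m + 1) m + 1))
    = Ept u s + Ept u (upd s m (s m + 1)).
  rewrite Ept_addS // (eq_Ept u (upd_upd _ _ _ _)) upd_at -addrA.
  by congr (Ept u (upd _ _ (_ + _))); apply: val_inj.
rewrite !D (C 1 0) // (C 2%:R 0) // (C 2%:R 1) //.
move: (Ept u s) (Ept u (upd s 0 _)) => p a.
move: (Ept u (upd s 1 _)) (Ept u (upd s 2%:R _)) => b c.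
move: (Ept u _) (Ept u _) (Ept u _) => x y z.
(* Gather the three pairs x, y, z of mixed terms and one pair of p. *)
rewrite [LHS](AC ((2*1*1)*(1*2*1)*(1*1*2))
  ((2*7*12*1)*((6*11)*(3*5)*(4*9)*(8*10))))%AC /=.
by rewrite !mx2_addrr !addr0.
Qed.

Lemma W_exists : exists W : GL8, GLval W = Wmx.
Proof.
apply: (@GL_of_mx 7 _ (Wmx + 1%:M)).
by rewrite mulmxDr mulmx1 Wmx_sqr [X in X + _]addrC mx2_addK.
Qed.

(** The predicate d records which factors fail to commute with [rot]; each
    contributes one copy of the tensor, and an even number of them cancels. *)
Lemma Wmx_tens3m (a : 'I_3 -> 'M_2) (d : pred 'I_3) :
  (forall m, GLval rot *m a m = a m *m GLval rot + (d m)%:R *: a m) ->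
  ~~ odd #|[set m | d m]| -> Wmx *m tens3m a = tens3m a *m Wmx.
Proof.
move=> ha; rewrite odd_card3 WmxE !mulmxDl !mulmxDr.
rewrite !(slot_mul (ha _)).
move: (tens3m a) (tens3m a *m _) (tens3m a *m _) (tens3m a *m _) => t x y z.
rewrite [LHS](AC (2*2*2) ((1*3*5)*(2*4*6)))%AC /= => even.
suffices -> : (d 0)%:R *: t + (d 1)%:R *: t + (d 2%:R)%:R *: t = 0.
  by rewrite addr0.
move: even; do 3!case: (d _);
  by rewrite ?scale1r ?scale0r ?add0r ?addr0 ?mx2_addrr.
Qed.

End WFacts.

(** * The group G_S^0 *)

Lemma N0P (H : {set GL2}) (g : GL8) : reflect
  (exists2 a : 'I_3 -> GL2, GLval g = tens3m (fun i => GLval (a i))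
     & ~~ odd #|[set i | a i \notin H]|)
  (g \in N0 H).
Proof.
rewrite inE; apply: (iffP existsP) => [[a /andP[/eqP Dg ev]] | [a Dg ev]].
  by exists a.
exists [ffun i => a i]; apply/andP; split.
  by rewrite Dg; apply/eqP; apply: eq_tens3m => i; rewrite ffunE.
rewrite (eq_card (_ : _ =i [set i | a i \notin H])) // => i.
by rewrite !inE ffunE.
Qed.

Lemma Sym3P (g : GL8) : reflect
  (exists s : 'S_3, forall x, tens3v x *m GLval g = tens3v (x \o s))
  (g \in Sym3).
Proof.
rewrite inE; apply: (iffP existsP) => [[s /forallP sP] | [s sP]].
  exists s => x; have /eqP := sP [ffun i => x i].
  rewrite V8actE (eq_tens3v (ffunE _)) => ->.
  by apply: eq_tens3v => i; rewrite /= ffunE.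
by exists s; apply/forallP => x; rewrite V8actE sP.
Qed.

Lemma Sym3_group_set : group_set Sym3.
Proof.
apply/group_setP; split=> [|g h /Sym3P[s sP] /Sym3P[t tP]]; apply/Sym3P.
  exists 1%g => x; rewrite GL1 mulmx1; apply: eq_tens3v => i.
  by rewrite /= perm1.
exists (t * s)%g => x; rewrite GLM mulmxA sP tP; apply: eq_tens3v => i.
by rewrite /= permM.
Qed.
Definition Sym3_group : {group GL8} := Group Sym3_group_set.

Lemma odd_notinM (gT : finGroupType) (H : {group gT}) (a b : 'I_3 -> gT) :
    #|[set: gT] : H|%g = 2%N ->
  odd #|[set i | (a i * b i)%g \notin H]|
    = odd #|[set i | a i \notin H]| (+) odd #|[set i | b i \notin H]|.
Proof.
move=> H2; rewrite !odd_card3 !index2_notinM //.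
by do 6!case: (_ \notin H).
Qed.

Section Group0.

Variable H : {group GL2}.
Hypothesis H_index2 : #|[set: GL2] : H|%g = 2%N.

Lemma N0_group_set : group_set (N0 H).
Proof.
apply/group_setP; split=> [|g h /N0P[a Dg a_ev] /N0P[b Dh b_ev]]; apply/N0P.
  by exists (fun=> 1%g); rewrite ?GL1 ?tens3m1 // odd_card3 group1.
exists (fun i => (a i * b i)%g); first by rewrite GLM Dg Dh tens3m_mul.
by rewrite odd_notinM // (negPf a_ev).
Qed.
Definition N0_group : {group GL8} := Group N0_group_set.

(** Conjugating a_0 (x) a_1 (x) a_2 by a permutation of the factors permutes
    the a_i. *)
Lemma Sym3_norm_N0 : (Sym3 \subset 'N(N0 H))%g.
Proof.
apply/subsetP => g /Sym3P[s sP]; rewrite inE.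
apply/subsetP => _ /imsetP[n /N0P[a Dn a_ev] ->]; apply/N0P.
have sVP x : tens3v x *m GLval g^-1%g = tens3v (x \o (s^-1)%g).
  have <- : tens3v (x \o (s^-1)%g) *m GLval g = tens3v x.
    by rewrite sP; apply: eq_tens3v => i; rewrite /= permK.
  exact: (@GLK _ 7).
exists (a \o s).
  apply: tens3v_ext => x; rewrite conjgE !GLM !mulmxA sVP Dn !tens3v_mul sP.
  by apply: eq_tens3v => i; rewrite /= permK.
suffices ->: [set i | (a \o s) i \notin H] = s @^-1: [set i | a i \notin H].
  by rewrite card_preimset //; apply: perm_inj.
by apply/setP => i; rewrite !inE.
Qed.

Variable u : 'I_3 -> V2.
Hypotheses (u_inj : injective u) (u_neq0 : forall i, u i != 0).

(** In a pure tensor map the m-th factor of the image depends on the m-th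
    factor only, so a permutation of the factors of this kind is trivial. *)
Lemma N0_Sym3_trivial : (N0 H :&: Sym3 = 1)%g.
Proof.
apply/(@trivgP _ (N0_group :&: Sym3_group)%G)/subsetP => g.
case/setIP => /N0P[a Dg _] /Sym3P[s sP].
have ua m i : exists j, u i *m GLval (a m) == u j.
  have [|j ->] := u_surj u_inj u_neq0 (_ : u i *m GLval (a m) != 0);
    last by exists j.
  apply: contraNneq (u_neq0 i) => ua0.
  by rewrite -[u i](@GLK _ 1 _ (a m)) ua0 mul0mx.
have s1 m : s m = m.
  pose p m i := xchoose (ua m i).
  have pE n i : u i *m GLval (a n) = u (p n i) by apply/eqP/(xchooseP (ua n i)).
  have Dp f : f \o s =1 (fun n => p n (f n)).
    apply: (Ept_inj u_inj u_neq0); rewrite /Ept.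
    rewrite -[LHS]/(tens3v ((u \o f) \o s)) -sP Dg tens3v_mul.
    by apply: eq_tens3v => n; rewrite /= pE.
  apply/eqP; apply/negPn/negP => sm.
  (* Change the factor at s m while the one at m stays the same. *)
  have := Dp (upd (fun=> 0) (s m) 0) m; have := Dp (upd (fun=> 0) (s m) 1) m.
  by rewrite /= !upd_at !upd_neq 1?eq_sym // => <- /eqP.
rewrite inE; apply/eqP/val_inj/tens3v_ext => x.
rewrite sP [RHS]mulmx1; apply: eq_tens3v => i; by rewrite /= s1.
Qed.

(** The internal semidirect product is a genuine one, not the empty set. *)
Lemma segre_group0E : segre_group0 H = (N0 H * Sym3)%g.
Proof.
exact: (@sdprodE _ N0_group Sym3_group Sym3_norm_N0 N0_Sym3_trivial).
Qed.

End Group0.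

(** * The centralizer *)

(** A tensor, given by its values V on triples of indices, that is trilinear
    (index 2 is the sum of 0 and 1) and invariant under exchanging 1 and 2 in
    any two places. Two places with index 0 give V 0 0 k = V 0 1 k + V 0 2 k
    = 0, and the three values with a single 0 and two 1 agree; so V is
    determined by V 1 1 1 and V 0 1 1. *)
Lemma fixed_table (V : 'I_3 -> 'I_3 -> 'I_3 -> 'F_2) :
  (forall j k, V 2%:R j k = V 0 j k + V 1 j k) ->
  (forall i k, V i 2%:R k = V i 0 k + V i 1 k) ->
  (forall i j, V i j 2%:R = V i j 0 + V i j 1) ->
  (forall i j k, V (- i) (- j) k = V i j k) ->
  (forall i j k, V (- i) j (- k) = V i j k) ->
  (forall i j k, V i (- j) (- k) = V i j k) ->
  V 1 1 1 = 0 -> V 0 1 1 = 0 -> forall i j k, V i j k = 0.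
Proof.
move=> L1 L2 L3 F12 F13 F23 V111 V011.
have E1 : - 1 = 2%:R :> 'I_3 by apply: val_inj.
have E0 : - 0 = 0 :> 'I_3 by apply: val_inj.
have addIl (x y : 'F_2) : x + y = x -> y = 0.
  by move/(canRL (addKr _)); rewrite addNr.
have addIr (x y : 'F_2) : x + y = y -> x = 0 by rewrite addrC; apply: addIl.
have Z12 k : V 0 0 k = 0.
  by apply: (addIr _ (V 0 1 k)); rewrite -L2 -E1 -{1}E0 F12.
have Z13 j : V 0 j 0 = 0.
  by apply: (addIr _ (V 0 j 1)); rewrite -L3 -E1 -{1}E0 F13.
have Z23 i : V i 0 0 = 0.
  by apply: (addIr _ (V i 0 1)); rewrite -L3 -E1 -{1}E0 F23.
have V101 : V 1 0 1 = 0.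
  have := F12 1 1 1; rewrite E1 L1 !L2 Z12 V011 V111 !addr0 add0r.
  exact: id.
have V110 : V 1 1 0 = 0.
  have := F13 1 1 1; rewrite E1 L1 !L3 Z13 V011 V111 !addr0 add0r.
  exact: id.
have V01 i j k : i != 2%:R -> j != 2%:R -> k != 2%:R -> V i j k = 0.
  by case: (I3P i) => ->; case: (I3P j) => ->; case: (I3P k) => ->.
have V1 i j k : j != 2%:R -> k != 2%:R -> V i j k = 0.
  move=> j2 k2; have [->|] := eqVneq i 2%:R; last by move/V01; apply.
  by rewrite L1 !V01 ?addr0.
have V2 i j k : k != 2%:R -> V i j k = 0.
  move=> k2; have [->|] := eqVneq j 2%:R; last by move/V1; apply.
  by rewrite L2 !V1 ?addr0.
move=> i j k; have [->|] := eqVneq k 2%:R; last by move/V2; apply.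
by rewrite L3 !V2 ?addr0.
Qed.

Section Centralizer.

Variable H : {group GL2}.
Hypothesis H_index2 : #|[set: GL2] : H|%g = 2%N.
Variable u : 'I_3 -> V2.
Hypotheses (u_inj : injective u) (u_neq0 : forall i, u i != 0).
Variable rot : GL2.
Hypothesis rotE : forall i, u i *m GLval rot = u (i + 1).
Variable W : GL8.
Hypothesis WE : GLval W = Wmx rot.

Lemma V8actW2 x : V8act (V8act x W) W = x + V8act x W.
Proof.
by rewrite !V8actE WE -mulmxA (Wmx_sqr u_inj u_neq0 rotE) mulmxDr mulmx1 addrC.
Qed.

Lemma W_cent_N0 : W \in 'C(N0 H)%g.
Proof.
apply/centP => g /N0P[a Dg a_ev]; apply: val_inj.
rewrite [LHS]GLM [RHS]GLM WE Dg; apply: Wmx_tens3m a_ev => m.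
exact: (rot_mul u_inj u_neq0 H_index2 rotE).
Qed.

Lemma W_cent_Sym3 : W \in 'C(Sym3)%g.
Proof.
apply/centP => g /Sym3P[s sP]; apply: val_inj; rewrite [LHS]GLM [RHS]GLM WE.
apply: tens3v_ext => x; rewrite !mulmxA sP /Wmx !mulmx_sumr mulmx_suml.
rewrite (reindex_inj (@perm_inj _ s)) /=; apply: eq_bigr => m _.
rewrite !tens3v_slot sP; apply: eq_tens3v => i; rewrite /upd /=.
by rewrite (inj_eq perm_inj).
Qed.

Lemma W_cent : W \in 'C(segre_group0 H)%g.
Proof.
rewrite (segre_group0E H_index2 u_inj u_neq0).
apply/centP => _ /mulsgP[g h gN hS ->].
by apply: commuteM; [apply: (centP W_cent_N0) | apply: (centP W_cent_Sym3)].
Qed.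

Lemma order_W : #[W]%g = 3%N.
Proof.
have W2 x : x *m GLval W *m GLval W = x + x *m GLval W := V8actW2 x.
apply: nt_prime_order => //.
  apply/val_inj/(Ept_ext u_inj u_neq0) => s.
  rewrite -[LHS]/(Ept u s *m (GLval W *m (GLval W *m GLval W))).
  rewrite -[RHS]/(Ept u s *m 1%:M).
  rewrite mulmx1 !mulmxA.
  by rewrite !W2 addrCA mx2_addrr addr0.
apply/eqP => W1; have := W2 (Ept u id).
rewrite W1 (_ : GLval 1%g = 1%:M) // !mulmx1 mx2_addrr.
by apply/eqP/(Ept_neq0 u_inj u_neq0).
Qed.

(** W^2 = W + 1, so the nontrivial elements of <W> are W and W + 1. *)
Lemma cycleWP (c : GL8) : reflect
  ((forall x, V8act x c = x) \/ (forall x, V8act x c = V8act x W)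
    \/ (forall x, V8act x c = x + V8act x W)) (c \in <[W]>%g).
Proof.
have ext g : (forall x, V8act x c = V8act x g) -> c = g.
  move=> cg; apply/val_inj/(Ept_ext u_inj u_neq0) => s.
  exact: (cg (Ept u s)).
apply: (iffP idP) => [|[c1 | [cW | cW2]]].
- case/cyclePmin=> [[|[|[|n]]]]; rewrite order_W // => _ ->.
  + by left=> x; rewrite expg0 V8act1.
  + by right; left=> x; rewrite expg1.
  + by right; right=> x; rewrite (expgS W 1) expg1 V8actM V8actW2.
- by rewrite (ext 1%g) ?group1 // => x; rewrite c1 V8act1.
- by rewrite (ext W) ?cycle_id.
- suffices ->: c = (W * W)%g by exact: mulg_cycle.
  by apply: ext => x; rewrite cW2 V8actM V8actW2.
Qed.

Lemma eq_tcoord k l v : k =1 l -> tcoord u k v = tcoord u l v.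
Proof.
by move=> kl; congr ((v *m _) 0 0); apply: (@eq_tens3 2 1) => i; rewrite kl.
Qed.

Lemma tcoord_lin k m v : k m = 2%:R ->
  tcoord u k v = tcoord u (upd k m 0) v + tcoord u (upd k m 1) v.
Proof.
move=> km; pose F l : 'cV_8 := tens3 (fun i => symp (u (l i))).
transitivity ((v *m (F (upd k m 0) + F (upd k m 1))) 0 0); last first.
  by rewrite mulmxDr mxE.
congr ((v *m _) 0 0).
apply: (@tens3D 2 1 _ _ _ m) => [|i im] /=; last by rewrite !upd_neq.
rewrite !upd_at km; apply: (u_ext u_inj u_neq0) => i; rewrite mulmxDr.
apply/matrixP => a b; rewrite !ord1 [RHS]mxE !u_symp //.
by case: (I3P i) => ->; apply: val_inj.
Qed.

Lemma flip_symp (flip : GL2) i : (forall j, u j *m GLval flip = u (- j)) ->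
  GLval flip *m symp (u i) = symp (u (- i)).
Proof.
move=> flipE; apply: (u_ext u_inj u_neq0) => j; rewrite mulmxA flipE.
by apply/matrixP => a b; rewrite !ord1 !u_symp // eqr_oppLR.
Qed.

Lemma forall_I3 (P : pred 'I_3) : [forall i, P i] = [&& P 0, P 1 & P 2%:R].
Proof.
apply/forallP/and3P => [Pi | [P0 P1 P2] i]; first by split.
by case: (I3P i) => ->.
Qed.

Let p : V8 := Ept u (fun=> 0).

(** It is enough to use the three elements of N_0 that are [flip] on two of the
    factors; they fix p since [flip] fixes u_0. The coefficient a is the value
    of v under a form that is 1 at p and 0 at pW, and b its value under a form
    that is 0 at p and 1 at pW. *)
Lemma N0_fixed v :
    (forall g, g \in N0 H -> V8act p g = p -> V8act v g = v) ->
  exists a b : 'F_2, v = a *: p + b *: V8act p W.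
Proof.
have [flip flipE] := flip_exists u_inj u_neq0.
have flipN := flip_notin u_inj u_neq0 H_index2 rotE flipE.
pose tri (i j k m : 'I_3) := if m == 0 then i else if m == 1 then j else k.
have fixed_tcoord w m k :
      (forall g, g \in N0 H -> V8act p g = p -> V8act w g = w) ->
    tcoord u (upd (fun i => - k i) m (k m)) w = tcoord u k w.
  move=> wfix; pose a := upd (fun=> flip) m 1%g.
  have [g Dg] := tens_GL a.
  have gN : g \in N0 H.
    apply/N0P; exists a => //; rewrite odd_card3 /a /upd /=.
    by case: (I3P m) => ->; rewrite /= group1 flipN.
  have pg : V8act p g = p.
    rewrite V8actE Dg [LHS]tens3v_mul; apply: eq_tens3v => i /=.
    rewrite /a /upd /=; case: eqP => _; first by rewrite mulmx1.
    by rewrite flipE oppr0.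
  rewrite -[in RHS](wfix g gN pg) /tcoord V8actE Dg -mulmxA.
  congr ((w *m _) 0 0).
  transitivity (tens3 (fun i => GLval (a i) *m symp (u (k i)))); last first.
    exact/esym/(tens3_mul (fun i => GLval (a i)) (fun i => symp (u (k i)))).
  apply: (@eq_tens3 2 1) => i; rewrite /a /upd /=.
  by case: eqP => [->|_]; [rewrite [RHS]mul1mx | rewrite flip_symp].
move=> vfix; pose a := tcoord u (tri 1 1 1) v; pose b := tcoord u (tri 0 1 1) v.
exists a, b; apply/eqP; rewrite -mx2_add_eq0; apply/eqP.
set w := v + _; pose V i j k := tcoord u (tri i j k) w.
have wfix g : g \in N0 H -> V8act p g = p -> V8act w g = w.
  move=> gN pg; rewrite !V8actD vfix // !V8actE -!scalemxAl -!V8actE pg.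
  by rewrite -!V8actM (centP W_cent_N0 g gN) V8actM pg.
suffices V0 : forall i j k, V i j k = 0.
  apply: (tcoord_sep u_inj u_neq0) => k.
  rewrite -[RHS](V0 (k 0) (k 1) (k 2%:R)); apply: eq_tcoord => m.
  by case: (I3P m) => ->.
have tcoordZ k (c : 'F_2) x : tcoord u k (c *: x) = c * tcoord u k x.
  by rewrite /tcoord -scalemxAl mxE.
apply: fixed_table.
- by move=> j k; rewrite /V (@tcoord_lin _ 0).
- by move=> i k; rewrite /V (@tcoord_lin _ 1).
- by move=> i j; rewrite /V (@tcoord_lin _ 2%:R).
- by move=> i j k; rewrite /V -(fixed_tcoord w 2%:R (tri i j k)).
- by move=> i j k; rewrite /V -(fixed_tcoord w 1 (tri i j k)).
- by move=> i j k; rewrite /V -(fixed_tcoord w 0 (tri i j k)).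
- rewrite /V /w !tcoordD !tcoordZ V8actE WE (Ept_W rotE).
  rewrite !tcoordD !tcoord_Ept //.
  rewrite !forall_I3 /= -/a.
  by case: (F2P a) (F2P b) => -> [] ->; apply: val_inj.
- rewrite /V /w !tcoordD !tcoordZ V8actE WE (Ept_W rotE).
  rewrite !tcoordD !tcoord_Ept //.
  rewrite !forall_I3 /= -/b.
  by case: (F2P a) (F2P b) => -> [] ->; apply: val_inj.
Qed.

(** Any E_s is the image of p under powers of [rot] in N_0, so the formula
    for c at p is carried to all of S. *)
Lemma cent_N0 c : c \in 'C(N0 H)%g -> c \in <[W]>%g.
Proof.
move=> /centP cC.
have [|a [b Dpc]] := @N0_fixed (V8act p c).
  by move=> g gN pg; rewrite -V8actM cC // V8actM pg.
have Ec : GLval c = a%:M + b *: GLval W.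
  apply: (Ept_ext u_inj u_neq0) => s.
  have [g Dg] := tens_GL (fun i => (rot ^+ s i)%g).
  have gN : g \in N0 H.
    apply/N0P; exists (fun i => (rot ^+ s i)%g) => //.
    have rotH i : (rot ^+ s i)%g \in H.
      by rewrite (index2_rot u_inj u_neq0 H_index2 rotE); apply: mem_cycle.
    by rewrite odd_card3 (rotH 0) (rotH 1) (rotH 2%:R).
  have pg : V8act p g = Ept u s.
    rewrite V8actE Dg [LHS]tens3v_mul; apply: eq_tens3v => i /=.
    by rewrite (rot_expE rotE) add0r natr_Zp.
  rewrite -!pg -!V8actE -V8actM -cC // V8actM Dpc V8actD !V8actE -!scalemxAl.
  rewrite mulmxDr mul_mx_scalar -scalemxAr -!V8actE; congr (_ + _ *: _).
  by rewrite -!V8actM (centP W_cent_N0 g gN).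
have xc x : V8act x c = a *: x + b *: V8act x W.
  by rewrite V8actE Ec mulmxDr mul_mx_scalar -scalemxAr.
apply/cycleWP; case: (F2P a) xc => ->; case: (F2P b) => -> xc.
- have := xc p; rewrite !scale0r addr0 => pc0.
  case/eqP: (Ept_neq0 u_inj u_neq0 (fun=> 0)).
  by rewrite -/p -[p](@GLK 1 7 p c) (_ : p *m GLval c = 0) // mul0mx.
- by right; left=> x; rewrite xc scale0r add0r scale1r.
- by left=> x; rewrite xc scale0r addr0 scale1r.
- by right; right=> x; rewrite xc !scale1r.
Qed.

Lemma cent_segre_group0 : 'C(segre_group0 H)%g = <[W]>%g.
Proof.
apply/eqP; rewrite eqEsubset cycle_subG W_cent andbT.
apply: subset_trans (_ : 'C(N0 H) \subset _)%g.
  rewrite (segre_group0E H_index2 u_inj u_neq0); apply: centS.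
  apply/subsetP => g gN; apply/mulsgP; exists g 1%g; rewrite ?mulg1 //.
  exact: (group1 Sym3_group).
by apply/subsetP => c; apply: cent_N0.
Qed.

End Centralizer.

(** * The action of the stabilizer of S on distinguished tangents *)

Lemma V8actK (x : V8) (g : GL8) : V8act (V8act x g) g^-1%g = x.
Proof. exact: (@GLK 1 7 x g). Qed.

Lemma V8actKV (x : V8) (g : GL8) : V8act (V8act x g^-1%g) g = x.
Proof. exact: (@GLKV 1 7 x g). Qed.

Lemma V8act_inj (g : GL8) : injective (V8act^~ g).
Proof. exact: (act_inj V8act g). Qed.

Lemma setV8actK (A : {set V8}) (g : GL8) :
  (V8act^*)%act ((V8act^*)%act A g) g^-1%g = A.
Proof.
rewrite /= !setactE -imset_comp (eq_imset _ (_ : _ =1 id)) ?imset_id // => x.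
exact: V8actK.
Qed.

Lemma setV8actKV (A : {set V8}) (g : GL8) :
  (V8act^*)%act ((V8act^*)%act A g^-1%g) g = A.
Proof.
rewrite /= !setactE -imset_comp (eq_imset _ (_ : _ =1 id)) ?imset_id // => x.
exact: V8actKV.
Qed.

Lemma mem_setV8act (A : {set V8}) (g : GL8) x :
  (V8act x g \in (V8act^*)%act A g) = (x \in A).
Proof. by rewrite /= setactE (mem_imset _ _ (@V8act_inj g)). Qed.

Lemma setact3 (x y z : V8) (g : GL8) : (V8act^*)%act [set x; y; z] g
  = [set V8act x g; V8act y g; V8act z g].
Proof. by rewrite /= setactE !imsetU !imset_set1. Qed.

Lemma V8act_neq0 (x : V8) (g : GL8) : (V8act x g != 0) = (x != 0).
Proof.
have act0 h : V8act 0 h = 0 by exact: mul0mx.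
by rewrite -[in LHS](act0 g) (inj_eq (@V8act_inj g)).
Qed.

Lemma span_act (A : {set V8}) (g : GL8) x :
  x \in <<enum A>>%VS -> V8act x g \in <<enum ((V8act^*)%act A g)>>%VS.
Proof.
move/(@coord_span _ _ _ (in_tuple (enum A))) => ->.
rewrite V8actE mulmx_suml; apply: memv_suml => i _; rewrite -scalemxAl.
apply/memvZ/memv_span; rewrite mem_enum; apply/imset_f.
by rewrite -mem_enum mem_nth // ltn_ord.
Qed.

Lemma flat_act (A : {set V8}) (g : GL8) x :
  (V8act x g \in flat ((V8act^*)%act A g)) = (x \in flat A).
Proof.
rewrite !inE V8act_neq0; congr (_ && _); apply/idP/idP; last exact: span_act.
by move/(span_act g^-1%g); rewrite V8actK setV8actK.
Qed.

Section Spread.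

Variable u : 'I_3 -> V2.
Hypotheses (u_inj : injective u) (u_neq0 : forall i, u i != 0).
Variable rot : GL2.
Hypothesis rotE : forall i, u i *m GLval rot = u (i + 1).
Variable W : GL8.
Hypothesis WE : GLval W = Wmx rot.

Lemma segre_stab_act g x : g \in segre_stab u ->
  (V8act x g \in segre u) = (x \in segre u).
Proof. exact: astabs_act. Qed.

Lemma generators_act g l : g \in segre_stab u ->
  ((V8act^*)%act l g \in generators u) = (l \in generators u).
Proof.
move=> gS; apply: (astabs_act l (_ : g \in 'N(generators u | V8act^*)%g)).
rewrite !inE; apply/subsetP => k.
case/(generator_lineP u_inj u_neq0) => x [y [xS yS xy xyS ->]].
rewrite inE setact3 V8actD; apply/(generator_lineP u_inj u_neq0).
exists (V8act x g), (V8act y g).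
by rewrite -V8actD !segre_stab_act // (inj_eq (@V8act_inj g)) V8actD.
Qed.

Lemma generators_at_act g p l : g \in segre_stab u ->
  ((V8act^*)%act l g \in generators_at u (V8act p g))
    = (l \in generators_at u p).
Proof.
move=> gS; apply/setIdP/setIdP; by rewrite generators_act // mem_setV8act.
Qed.

Lemma Zflat_act g p x : g \in segre_stab u ->
  (V8act x g \in Zflat u (V8act p g)) = (x \in Zflat u p).
Proof.
move=> gS; rewrite /Zflat -[RHS](flat_act _ g); congr (_ \in flat _).
apply/setP => y; rewrite -[y](V8actKV _ g) mem_setV8act.
move: (V8act y g^-1%g) => {}y; apply/bigcupP/bigcupP => [[l lp yl] | [l lp yl]].
  exists ((V8act^*)%act l g^-1%g).
    by rewrite -(generators_at_act _ _ gS) setV8actKV.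
  by rewrite -[y](V8actK _ g) mem_setV8act.
by exists ((V8act^*)%act l g); rewrite ?generators_at_act ?mem_setV8act.
Qed.

Lemma dist_tangentP p x : reflect
  (x = p \/ [/\ x \in Zflat u p & forall l l', l \in generators_at u p ->
     l' \in generators_at u p -> l != l' -> x \notin flat (l :|: l')])
  (x \in dist_tangent u p).
Proof.
rewrite in_setU1.
apply: (iffP orP) => [[/eqP-> | /setIdP[xZ /forall_inP xP]] | [-> | [xZ xP]]].
- by left.
- right; split=> // l l' /xP/forall_inP lP /lP /implyP; apply.
- by left.
- right; apply/setIdP; split=> //; apply/forall_inP => l lp.
  by apply/forall_inP => l' l'p; apply/implyP; apply: xP.
Qed.

Lemma dist_tangent_act g p : g \in segre_stab u ->
  (V8act^*)%act (dist_tangent u p) g = dist_tangent u (V8act p g).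
Proof.
have sub h q x : h \in segre_stab u -> x \in dist_tangent u q ->
    V8act x h \in dist_tangent u (V8act q h).
  move=> hS /dist_tangentP[-> | [xZ xP]];
    apply/dist_tangentP; [by left | right].
  split=> [|l l']; first by rewrite Zflat_act.
  rewrite -[l](setV8actKV _ h) -[l'](setV8actKV _ h) !generators_at_act //.
  move: (_ l _) (_ l' _) => {}l {}l' lq l'q ll'.
  rewrite /= !setactE -imsetU -setactE flat_act xP //.
  by apply: contraNneq ll' => ->.
move=> gS; apply/setP => x; rewrite -[x](V8actKV _ g) mem_setV8act.
move: (V8act x g^-1%g) => {}x; apply/idP/idP => [|xg]; first exact: sub.
by rewrite -[x](V8actK _ g) -[p](V8actK _ g) sub // groupV.
Qed.

End Spread.

(** * Distinguished tangents are orbits of W *)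

(** Over GF(2) a subset closed under sums is closed under linear
    combinations. *)
Lemma span_ind (A : {set V8}) (P : V8 -> Prop) :
  P 0 -> (forall x y, P x -> P y -> P (x + y)) ->
  (forall x, x \in A -> P x) -> forall x, x \in <<enum A>>%VS -> P x.
Proof.
move=> P0 PD PA x /(@coord_span _ _ _ (in_tuple (enum A))) ->.
apply: big_ind => // i _.
case: (F2P (coord (in_tuple (enum A)) i x)) => ->; rewrite ?scale0r //.
have: (in_tuple (enum A))`_i \in A by rewrite -mem_enum mem_nth // ltn_ord.
by rewrite scale1r => /PA.
Qed.

Section Tangent.

Variable u : 'I_3 -> V2.
Hypotheses (u_inj : injective u) (u_neq0 : forall i, u i != 0).
Variable rot : GL2.
Hypothesis rotE : forall i, u i *m GLval rot = u (i + 1).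
Variable W : GL8.
Hypothesis WE : GLval W = Wmx rot.

Lemma tcoord_flat (A : {set V8}) k x :
  (forall y, y \in A -> tcoord u k y = 0) -> x \in flat A -> tcoord u k x = 0.
Proof.
move=> A0 /setIdP[_]; move: x; apply: span_ind => // [|x y x0 y0].
  by rewrite /tcoord mul0mx mxE.
by rewrite tcoordD x0 y0 addr0.
Qed.

Section AtPoint.

Variable s : 'I_3 -> 'I_3.
Let p := Ept u s.
Let q m := Ept u (upd s m (s m + 1)).

Lemma Ept_V8actW : V8act p W = \sum_m q m.
Proof. by rewrite V8actE WE (Ept_W rotE) sumI3. Qed.

Lemma gen_line_at m : gen_line u m s = [set p; q m; p + q m].
Proof.
rewrite (gen_line_split u_inj u_neq0 _ _ (_ : s m != s m + 1)).
  by rewrite (eq_Ept u (upd_id s m)).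
by case: (I3P (s m)) => ->.
Qed.

Lemma generators_atP l :
  reflect (exists m, l = gen_line u m s) (l \in generators_at u p).
Proof.
apply: (iffP setIdP) => [[/generatorsP[m [t ->]]] | [m ->]].
  case/imsetP => i _ /(Ept_inj u_inj u_neq0) st; exists m.
  apply: eq_imset => j; apply: eq_Ept => n.
  by rewrite /upd /=; case: eqP => // /eqP nm; rewrite st upd_neq.
split; first by apply/generatorsP; exists m, s.
by rewrite gen_line_at !inE eqxx.
Qed.

Lemma q_gen_line m n : (q m \in gen_line u n s) = (m == n).
Proof.
apply/imsetP/eqP => [[i _ /(Ept_inj u_inj u_neq0)/(_ m)] | <-];
  last by exists (s m + 1).
rewrite upd_at; apply: contra_eq => mn; rewrite upd_neq //.
by case: (I3P (s m)) => ->.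
Qed.

Lemma Zflat_coord x : x \in Zflat u p ->
  exists a (b : 'I_3 -> 'F_2), x = a *: p + \sum_m b m *: q m.
Proof.
case/setIdP => _; move: x; apply: span_ind.
- exists 0, (fun=> 0); rewrite scale0r big1 ?addr0 // => m _.
  by rewrite scale0r.
- move=> _ _ [a [b ->]] [c [d ->]]; exists (a + c), (fun m => b m + d m).
  rewrite addrACA scalerDl -big_split /=; congr (_ + _).
  by apply: eq_bigr => m _; rewrite scalerDl.
move=> x /bigcupP[_ /generators_atP[m ->]]; rewrite gen_line_at.
have qE : q m = \sum_n (n == m)%:R *: q n.
  rewrite (bigD1 m) //= eqxx scale1r big1 ?addr0 // => n /negPf->.
  exact: scale0r.
rewrite !inE -orbA => /or3P[] /eqP->.
- exists 1, (fun=> 0); rewrite scale1r big1 ?addr0 // => n _.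
  by rewrite scale0r.
- by exists 0, (fun n => (n == m)%:R); rewrite scale0r add0r -qE.
by exists 1, (fun n => (n == m)%:R); rewrite scale1r -qE.
Qed.

(** A zero coefficient at q_m puts a point of Z(p) in the plane of the two
    other generators. Conversely, take a form whose m-th index is that of p and
    whose other two indices differ from those of p: it vanishes on p and on
    the other two generators, but not on q_m, hence not on pW and p + pW. *)
Lemma dist_tangent_Ept :
  dist_tangent u p = [set p; V8act p W; p + V8act p W].
Proof.
apply/setP => x; apply/dist_tangentP/idP => [[-> | [xZ xP]] | ].
- by rewrite !inE eqxx.
- have [a [b Dx]] := Zflat_coord xZ.
  have x0 : x != 0 by case/setIdP: xZ; rewrite inE.
  suffices b1 m : b m = 1.
    rewrite !inE Dx (eq_bigr q) => [|m _]; last by rewrite b1 scale1r.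
    rewrite -Ept_V8actW.
    case: (F2P a) => ->; rewrite ?scale0r ?scale1r ?add0r eqxx ?orbT //.
  case: (F2P (b m)) => // bm0.
  have /negP[] :
      x \notin flat (gen_line u (m + 1) s :|: gen_line u (m + 2%:R) s).
    apply: xP.
    - by apply/generators_atP; exists (m + 1).
    - by apply/generators_atP; exists (m + 2%:R).
    apply/eqP => /setP/(_ (q (m + 1))); rewrite !q_gen_line eqxx.
    by case: (I3P m) => ->.
  rewrite !inE x0 Dx memvD ?memv_suml //.
    by rewrite memvZ // memv_span // mem_enum inE gen_line_at !inE eqxx.
  move=> n _; have [->|nm] := eqVneq n m; first by rewrite bm0 scale0r mem0v.
  rewrite memvZ // memv_span // mem_enum inE !q_gen_line.
  by move: nm; case: (I3P m) => ->; case: (I3P n) => ->.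
rewrite !inE -orbA => /or3P xD.
have [-> | xp] := eqVneq x p; [by left | right].
have x0 : x != 0.
  case: xD => /eqP->; first exact: Ept_neq0.
    by rewrite V8act_neq0 Ept_neq0.
  by rewrite -(V8actW2 u_inj u_neq0 rotE WE) !V8act_neq0 Ept_neq0.
have {xD} [a Dx] : exists a, x = a *: p + \sum_m q m.
  case: xD => /eqP Dx; first by rewrite Dx eqxx in xp.
    by exists 0; rewrite scale0r add0r -Ept_V8actW.
  by exists 1; rewrite scale1r -Ept_V8actW.
have x_out n l : n != l -> x \notin flat (gen_line u n s :|: gen_line u l s).
  move=> nl; pose m := - (n + l); pose k i := if i == m then s i else s i + 1.
  have mn : m != n.
    by rewrite /m; move: nl; case: (I3P n) => ->; case: (I3P l) => ->.
  have ml : m != l.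
    by rewrite /m; move: nl; case: (I3P n) => ->; case: (I3P l) => ->.
  have k_out t : t m = s m -> tcoord u k (Ept u t) = 0.
    move=> tm; rewrite tcoord_Ept //; case: forallP => // /(_ m).
    by rewrite /k eqxx tm eqxx.
  have line0 i y : m != i -> y \in gen_line u i s -> tcoord u k y = 0.
    by move=> mi /imsetP[j _ ->]; rewrite k_out // upd_neq.
  apply/negP => /(@tcoord_flat _ k) x_span.
  have {x_span} : tcoord u k x = 0.
    by apply: x_span => y; rewrite inE => /orP[]; apply: line0.
  have tcoordZ (c : 'F_2) y : tcoord u k (c *: y) = c * tcoord u k y.
    by rewrite /tcoord -scalemxAl mxE.
  have kq i : i != m -> tcoord u k (q i) = 0.
    by move=> im; rewrite k_out // upd_neq // eq_sym.
  have kqm : tcoord u k (q m) = 1.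
    rewrite tcoord_Ept //; case: forallP => // [[]] i.
    rewrite /k /upd /=; case: (i =P m) => [->|_].
      by case: (I3P (s m)) => ->.
    by case: (I3P (s i)) => ->.
  have -> : tcoord u k x = 1; last by [].
  rewrite Dx tcoordD tcoordZ (k_out s) // mulr0 add0r -kqm.
  by rewrite /tcoord mulmx_suml summxE (bigD1 m) //= big1 ?addr0.
split=> [|l l' /generators_atP[n ->] /generators_atP[n' ->] ll']; last first.
  by apply: x_out; apply: contraNneq ll' => ->.
rewrite x0 /=.
rewrite Dx memvD ?memv_suml //.
  rewrite memvZ // memv_span // mem_enum; apply/bigcupP.
  exists (gen_line u 0 s); first by apply/generators_atP; exists 0.
  by rewrite gen_line_at !inE eqxx.
move=> m _; rewrite memv_span // mem_enum; apply/bigcupP.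
exists (gen_line u m s); first by apply/generators_atP; exists m.
by rewrite q_gen_line.
Qed.

End AtPoint.
End Tangent.

(** * The spread *)

Lemma F2_common_scalar (a b c : 'F_2) (x y : V8) : x != 0 -> y != 0 ->
  a *: x + b *: y = c *: (x + y) -> a = b.
Proof.
move=> /eqP x0 /eqP y0; have shift (z t : V8) : z = z + t -> t = 0.
  by rewrite -[in LHS](addr0 z) => /addrI.
case: (F2P a) (F2P b) (F2P c) => -> [] -> [] -> //;
  rewrite ?scale0r ?scale1r ?add0r ?addr0 //.
- by rewrite addrC => /shift.
- by move/shift.
Qed.

Section Spread.

Variable u : 'I_3 -> V2.
Hypotheses (u_inj : injective u) (u_neq0 : forall i, u i != 0).
Variable rot : GL2.
Hypothesis rotE : forall i, u i *m GLval rot = u (i + 1).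
Variable W : GL8.
Hypothesis WE : GLval W = Wmx rot.

Let V8actWW := V8actW2 u_inj u_neq0 rotE WE.

Lemma V8actW_neq x : x != 0 -> V8act x W != x.
Proof.
apply: contraNneq => Wx; have := V8actWW x.
by rewrite !Wx mx2_addrr => ->.
Qed.

Lemma orbit_W x : orbit V8act <[W]>%g x = [set x; V8act x W; x + V8act x W].
Proof.
apply/setP => y; rewrite !inE -orbA; apply/orbitP/or3P => [[c cW <-] | ].
  case/(cycleWP u_inj u_neq0 rotE WE): cW => [-> | [-> | ->]]; rewrite eqxx;
  by [apply: Or31 | apply: Or32 | apply: Or33].
case=> /eqP->.
- by exists 1%g; rewrite ?group1 ?V8act1.
- by exists W; rewrite ?cycle_id.
- exists (W * W)%g; first exact: mulg_cycle.
  by rewrite V8actM V8actWW.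
Qed.

Lemma card_orbit_W x : x != 0 -> #|orbit V8act <[W]>%g x| = 3%N.
Proof.
move=> x0; have Wx := V8actW_neq x0.
have: V8act x W != V8act (V8act x W) W.
  by rewrite eq_sym V8actW_neq ?V8act_neq0.
have: x != V8act (V8act x W) W.
  rewrite V8actWW -[X in X != _]addr0 (inj_eq (addrI x)) eq_sym.
  by rewrite V8act_neq0.
rewrite orbit_W V8actWW => n1 n2.
by rewrite -setUA cardsU1 cards2 n2 !inE negb_or n1 eq_sym Wx.
Qed.

(** The conjugate of W also moves each p in S along the tangent L(p), so it
    differs from W at p by a multiple A(p) p; A is constant along generators
    by linearity and hence constant. *)
Lemma segre_stab_norm_W g : g \in segre_stab u -> (W ^ g)%g \in <[W]>%g.
Proof.
move=> gS; set Wg := (W ^ g)%g.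
have WgE x : V8act x Wg = V8act (V8act (V8act x g^-1%g) W) g.
  by rewrite /Wg conjgE -!V8actM mulgA.
pose A s : 'F_2 := (V8act (Ept u s) Wg == Ept u s + V8act (Ept u s) W)%:R.
have AE s : V8act (Ept u s) Wg = V8act (Ept u s) W + A s *: Ept u s.
  have [t Dt] : exists t, V8act (Ept u s) g^-1%g = Ept u t.
    by apply/segreP; rewrite -(segre_stab_act _ gS) V8actKV Ept_segre.
  have ts : V8act (Ept u t) g = Ept u s by rewrite -Dt V8actKV.
  have : V8act (Ept u s) Wg \in dist_tangent u (Ept u s).
    rewrite WgE Dt -ts -dist_tangent_act // mem_setV8act.
    by rewrite (dist_tangent_Ept u_inj u_neq0 rotE WE) !inE eqxx orbT.
  have Wg_neq : V8act (Ept u s) Wg != Ept u s.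
    rewrite WgE Dt -ts (inj_eq (@V8act_inj g)).
    by apply: V8actW_neq; apply: Ept_neq0.
  rewrite (dist_tangent_Ept u_inj u_neq0 rotE WE) !inE (negPf Wg_neq) orFb /A.
  have [/eqP D _ | _] :=
      boolP (V8act (Ept u s) Wg == Ept u s + V8act (Ept u s) W).
    by rewrite D scale1r addrC.
  by rewrite orbF scale0r addr0 => /eqP.
have A_line s m i : A (upd s m i) = A s.
  have [<- | neq_i] := eqVneq (s m) i.
    by rewrite /A (eq_Ept u (upd_id s m)).
  have := AE (upd s m (- (s m + i))).
  rewrite -(Ept_upd_add u_inj u_neq0 s m neq_i) (eq_Ept u (upd_id s m)).
  rewrite !V8actD !AE addrACA => /addrI sum_eq.
  have s0 := Ept_neq0 u_inj u_neq0 s.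
  have si0 := Ept_neq0 u_inj u_neq0 (upd s m i).
  by rewrite (F2_common_scalar s0 si0 sum_eq).
(* Any s is reached from 0 by changing one index at a time. *)
have A_const s : A s = A (fun=> 0).
  pose t := upd (upd (upd (fun=> 0) 0 (s 0)) 1 (s 1)) 2%:R (s 2%:R).
  rewrite -[RHS](_ : A t = _); last by rewrite !A_line.
  by rewrite /A (@eq_Ept u s t) // => m; case: (I3P m) => ->.
have WgW x : V8act x Wg = V8act x W + A (fun=> 0) *: x.
  rewrite !V8actE -mul_mx_scalar -mulmxDr; congr (_ *m _).
  apply: (Ept_ext u_inj u_neq0) => s.
  by rewrite mulmxDr mul_mx_scalar -(A_const s) -!V8actE AE.
apply/(cycleWP u_inj u_neq0 rotE WE); case: (F2P (A (fun=> 0))) WgW => -> WgW.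
  by right; left=> x; rewrite WgW scale0r addr0.
by right; right=> x; rewrite WgW scale1r addrC.
Qed.

Lemma segre_stab_normal : (segre_stab u \subset 'N(<[W]>))%g.
Proof.
apply/subsetP => g gS; rewrite inE -cycleJ.
by rewrite cycle_subG segre_stab_norm_W.
Qed.

Lemma orbits_spread : is_line_spread [set orbit V8act <[W]>%g x | x in points].
Proof.
split=> [_ /imsetP[x x0 ->] | ].
  rewrite inE in x0; exists x, (V8act x W).
  by rewrite V8act_neq0 x0 eq_sym V8actW_neq ?orbit_W.
apply: orbit_partition; apply/subsetP => g _; rewrite !inE.
by apply/subsetP => x; rewrite !inE V8act_neq0.
Qed.

Lemma card_orbits : #|[set orbit V8act <[W]>%g x | x in points]| = 85%N.
Proof.
apply/eqP; rewrite -(@eqn_pmul2r 3) //.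
rewrite -(card_uniform_partition _ orbits_spread.2).
  rewrite (_ : points = [set~ 0]) ?cardsC1 ?card_mx ?card_ord //.
  by apply/setP => x; rewrite !inE.
move=> _ /imsetP[x x0 ->]; rewrite inE in x0.
exact: card_orbit_W.
Qed.

Lemma acts_orbits :
  [acts segre_stab u, on [set orbit V8act <[W]>%g x | x in points] | V8act^*]%g.
Proof.
apply/subsetP => g gS; rewrite !inE; apply/subsetP => _ /imsetP[x x0 ->].
rewrite inE in x0.
rewrite inE /= (setact_orbit V8act) (normP (subsetP segre_stab_normal g gS)).
by apply: imset_f; rewrite inE V8act_neq0.
Qed.

Lemma acts_dist_tangents : [acts segre_stab u, on dist_tangents u | V8act^*]%g.
Proof.
apply/subsetP => g gS; rewrite !inE; apply/subsetP => _ /imsetP[p pS ->].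
by rewrite inE dist_tangent_act // imset_f // segre_stab_act.
Qed.

Lemma dist_tangent_fix :
  {in segre u, forall p, (V8act^*)%act (dist_tangent u p) W = dist_tangent u p}.
Proof.
move=> _ /segreP[s ->]; rewrite (dist_tangent_Ept u_inj u_neq0 rotE WE) setact3.
by rewrite V8actD V8actWW addrCA mx2_addrr addr0 setUC setUA.
Qed.

(** The identity u_2 = u_0 + u_1 removes the index 2 from the images under W
    of the eight basis points. *)
Lemma W_specP : W_spec u W.
Proof.
have spec i j k : V8act (E u i j k) W
    = E u (i + 1) j k + E u i (j + 1) k + E u i j (k + 1).
  pose t (m : 'I_3) := if m == 0 then i else if m == 1 then j else k.
  rewrite -[E u i j k]/(Ept u t).
  by rewrite V8actE WE (Ept_W rotE).
have e11 : 1 + 1 = 2%:R :> 'I_3 by [].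
have e01 : 0 + 1 = 1 :> 'I_3 by rewrite add0r.
have e2 : - (0 + 1) = 2%:R :> 'I_3 by apply: val_inj.
have E2 i j k : [/\ E u 2%:R j k = E u 0 j k + E u 1 j k,
    E u i 2%:R k = E u i 0 k + E u i 1 k
    & E u i j 2%:R = E u i j 0 + E u i j 1].
  pose t (m : 'I_3) : 'I_3 := if m == 0 then i else if m == 1 then j else k.
  have add01 m : Ept u (upd t m 2%:R) = Ept u (upd t m 0) + Ept u (upd t m 1).
    by rewrite -e2 Ept_upd_add.
  by split; [apply: (add01 0) | apply: (add01 1) | apply: (add01 2%:R)].
have E2_1 j k := let: And3 e _ _ := E2 j j k in e.
have E2_2 i k := let: And3 _ e _ := E2 i i k in e.
have E2_3 i j := let: And3 _ _ e := E2 i j i in e.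
rewrite /W_spec; cbv zeta; rewrite !spec !e01 !e11 !E2_1 !E2_2 !E2_3.
move: (E u 0 0 0) (E u 1 0 0) (E u 1 1 0) (E u 0 1 0) => a b c d.
move: (E u 1 0 1) (E u 0 0 1) (E u 0 1 1) (E u 1 1 1) => e f g h.
split; split.
- by [].
- by rewrite [a + b]addrC.
- by rewrite [LHS](AC (2*2*1) ((3*1*5)*(2*4)))%AC /= mx2_addrr addr0.
- by rewrite [LHS](AC (1*2*1) (3*2*1*4))%AC.
- by rewrite [LHS](AC (3*2) ((4*1*3)*(2*5)))%AC /= mx2_addrr addr0.
- by rewrite [LHS](AC (2*2) (4*3*1*2))%AC.
- by rewrite [LHS](AC (1*2*2) ((4*2*1)*(3*5)))%AC /= mx2_addrr addr0.
- by rewrite [LHS](AC (2*2*2) ((2*5*3*1)*(4*6)))%AC /= mx2_addrr addr0.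
Qed.

End Spread.

Theorem theorem5 (u : 'I_3 -> V2) (u_inj : injective u)
    (u_neq0 : forall i : 'I_3, u i != 0)
    (H : {group GL2}) (H_index2 : #|[set: GL2] : H|%g = 2%N) :
  exists W : GL8,
    [/\ W_spec u W,
        'C(segre_group0 H)%g = <[W]>%g /\ (<[W]> \isog Zp 3)%g,
        {in segre u, forall p, (V8act^*)%act (dist_tangent u p) W = dist_tangent u p},
        [acts segre_stab u, on dist_tangents u | V8act^*]%g
      & let L85 := [set orbit V8act <[W]>%g x | x in points] in
        [/\ is_line_spread L85, #|L85| = 85%N
          & [acts segre_stab u, on L85 | V8act^*]%g]].
Proof.
have [rot rotE] := rot_exists u_inj u_neq0.
have [W WE] := W_exists u_inj u_neq0 rotE.
exists W; split.
- exact: (W_specP u_inj u_neq0 rotE WE).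
- split; first exact: (cent_segre_group0 H_index2 u_inj u_neq0 rotE WE).
  by have := Zp_isog W; rewrite (order_W u_inj u_neq0 rotE WE) isog_sym.
- exact: (dist_tangent_fix u_inj u_neq0 rotE WE).
- exact: (acts_dist_tangents u_inj u_neq0).
split.
- exact: (orbits_spread u_inj u_neq0 rotE WE).
- exact: (card_orbits u_inj u_neq0 rotE WE).
exact: (acts_orbits u_inj u_neq0 rotE WE).
Qed.
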